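(* Let $n\ge 1$. The family of $C^*$-algebras $\{\mathcal{W}_{1,n;I}\}$, indexed by the bounded Borel subsets $I\subset\mathbb{R}$, has the following properties. (i) It is factorizable: for every bounded Borel set $I\subset\mathbb{R}$ and every finite Borel partition $\pi$ of $I$ there is a $C^*$-algebra isomorphism $$u_{I,\pi}:\bigotimes_{I_j\in\pi}\mathcal{W}_{1,n;I_j}\to\mathcal{W}_{1,n;I}.$$ (ii) For such isomorphisms $u_{I,\pi}$, the operators $W_I(u,P)=\tilde z_I(W^0_I(u,P))\in\mathcal{W}_{1,n;I}$ are factorizable: for every bounded Borel set $I$, every $(u,P)\in\mathbb{R}\times\mathbb{R}_n[X]$ and every finite Borel partition $\pi$ of $I$ there exist operators $w_{I_j}\in\mathcal{W}_{1,n;I_j}$ ($I_j\in\pi$) such that $$u_{I,\pi}^{-1}(W_I(u,P))=\bigotimes_{I_j\in\pi}w_{I_j}.$$ That is, the family $(u_{I,\pi})$ in (i) can be chosen so that (ii) holds.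
   Context: Conventions. Bounded Borel sets $I\subset\mathbb{R}$ (including all cells of partitions) have strictly positive Lebesgue measure $|I|$, and sets differing by a Lebesgue-null set are identified. $Part_{fin}(I)$ is the set of finite Borel partitions of $I$; $\pi\prec\pi'$ means that $\pi'$ refines $\pi$. A $C^*$-cross norm is fixed once and for all and all tensor products of $C^*$-algebras are taken with respect to it. Group. $\mathbb{R}_n[X]$ is the space of real polynomials of degree $\le n$. For $u,w\in\mathbb{R}$ define linear maps on $\mathbb{R}_n[X]$ by $(S_uP)(X)=P(X+u)$, $T_w1=1$ and $T_w(X^k)=X^k+\sum_{h=0}^{k-1}\frac{k!}{(k+1-h)!\,h!}w^{k-h}X^h$ for $1\le k\le n$ (each $T_w$ is invertible). The group $\mathrm{Heis}(1,n)$ is the set of symbols $e^{\ell_0(u,P)}$, $(u,P)\in\mathbb{R}\times\mathbb{R}_n[X]$, with the multiplication induced by the group law $(u,P)\circ(v,Q)=(u+v,\,T_{u+v}^{-1}(T_uP+T_vS_uQ))$ on $\mathbb{R}\times\mathbb{R}_n[X]$. For a bounded Borel set $I$ put $\hat k_I(u,P)=(u|I|^{1/2},P_I)$, where $P_I(X)=\sum_{j=0}^n a_j|I|^{1-j/2}X^j$ if $P=\sum_{j=0}^n a_jX^j$. The group $\mathrm{Heis}(1,n,\mathbb{R}\chi_I)$ is the set of symbols $e^{\ell_I(u,P)}$, $(u,P)\in\mathbb{R}\times\mathbb{R}_n[X]$, with the multiplication for which $e^{\ell_I(u,P)}\mapsto e^{\ell_0(\hat k_I(u,P))}$ is a group isomorphism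 onto $\mathrm{Heis}(1,n)$; it is the simply connected Lie group of the Lie algebra with generators $L_0(\chi_I),\dots,L_{n+1}(\chi_I)$ and only nonzero brackets $[L_{n+1}(\chi_I),L_k(\chi_I)]=kL_{k-1}(\chi_I)$, $1\le k\le n$. Algebras. For a group $G$, $\mathcal{W}(G)$ (the free group-$C^*$-algebra) is the completion of the $*$-algebra with linear basis $\{W_g:g\in G\}$, $W_gW_h=W_{gh}$, $W_g^*=W_{g^{-1}}$, $1=W_e$, under the norm $\|x\|=\sup\|\pi(x)\|$ over all $*$-representations $\pi$. Put $\mathcal{W}^0_{1,n}=\mathcal{W}(\mathrm{Heis}(1,n))$ with generators $W^0(u,P)=W_{e^{\ell_0(u,P)}}$, and $\mathcal{W}^0_{1,n;I}=\mathcal{W}(\mathrm{Heis}(1,n,\mathbb{R}\chi_I))$ with generators $W^0_I(u,P)=W_{e^{\ell_I(u,P)}}$. Let $s_I:\mathcal{W}^0_{1,n;I}\to\mathcal{W}^0_{1,n}$ be the $C^*$-isomorphism with $s_I(W^0_I(u,P))=W^0(u,P)$ for all $(u,P)$. Inductive limit. For $\pi=(I_j)_{j\in F}\in Part_{fin}(I)$ put $\mathcal{W}^0_{1,n;I;\pi}=\bigotimes_{j\in F}\mathcal{W}^0_{1,n;I_j}$. For $\pi\prec\pi'$ define the $C^*$-embedding $$z_{I;\pi,\pi'}=\bigotimes_{j\in F}\Big(\Big(\bigotimes^{(diag)}_{I_j\supseteq I'\in\pi'}s_{I'}^{-1}\Big)\circ s_{I_j}\Big):\mathcal{W}^0_{1,n;I;\pi}\to\mathcal{W}^0_{1,n;I;\pi'},$$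 where $\bigotimes^{(diag)}_{I'}s_{I'}^{-1}$ is the $*$-homomorphism on $\mathcal{W}^0_{1,n}$ determined by $W^0(u,P)\mapsto\bigotimes_{I'}W^0_{I'}(u,P)$. These form an inductive system indexed by $Part_{fin}(I)$; its inductive limit $C^*$-algebra is $\mathcal{W}_{1,n;I}$, with canonical embeddings $\tilde z_{I;\pi}:\mathcal{W}^0_{1,n;I;\pi}\to\mathcal{W}_{1,n;I}$ satisfying $\tilde z_{I;\pi'}z_{I;\pi,\pi'}=\tilde z_{I;\pi}$ for $\pi\prec\pi'$. Put $\tilde z_I=\tilde z_{I;\{I\}}:\mathcal{W}^0_{1,n;I}\to\mathcal{W}_{1,n;I}$. *)

(* Defs.v *)
From HB Require Import structures.
From mathcomp Require Import all_boot all_order all_algebra ring.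
Set Implicit Arguments.
Unset Strict Implicit.
Unset Printing Implicit Defensive.
Import Order.TTheory GRing.Theory Num.Theory.
Local Open Scope ring_scope.

Definition heis (R : realFieldType) (n : nat) : Type :=
  (R * {poly_n.+1 R})%type.
HB.instance Definition _ (R : realFieldType) (n : nat) :=
  Choice.copy (heis R n) (R * {poly_n.+1 R})%type.

Section Heis.
Variables (R : realFieldType) (n : nat).
Notation polyn := {poly_n.+1 R}.
Notation heis := (heis R n).

(* [npolyp] truncates; all polynomials below have degree at most n. *)
Definition Sshift (u : R) (P : polyn) : polyn :=
  @npolyp R n.+1 ((P : {poly R}) \Po ('X + u%:P)).

Definition Tmono (w : R) (k : nat) : {poly R} :=
  'X^k + \sum_(h < k)
    ((k`!)%:R / ((k.+1 - h)`! * h`!)%:R * w ^+ (k - h)) *: 'X^h.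

Definition Tfun (w : R) (P : polyn) : polyn :=
  @npolyp R n.+1 (\sum_(k < n.+1) P`_k *: Tmono w k).

Definition Tmap (w : R) : 'End(polyn) := linfun (Tfun w).

Lemma SshiftE (u : R) (P : polyn) :
  (Sshift u P : {poly R}) = (P : {poly R}) \Po ('X + u%:P).
Proof.
by rewrite npolypK // size_comp_poly2 ?size_XaddC // size_npoly.
Qed.

Lemma TmonoE (w : R) (k : nat) : (k <= n)%N ->
  Tmono w k = \sum_(m < n.+1) (w ^+ m / (m.+1`!)%:R) *: derivn m 'X^k.
Proof.
move=> kn; pose F m := (w ^+ m / (m.+1`!)%:R) *: derivn m ('X^k : {poly R}).
rewrite -(big_mkord xpredT F) /= (big_cat_nat _ (n := k.+1)) //=.
rewrite [X in _ + X]big_nat_cond [X in _ + X]big1 ?addr0; last first.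
  by move=> m /andP[/andP[km _] _]; rewrite /F derivnXn ffact_small ?mulr0n ?scaler0.
rewrite big_mkord (reindex_inj rev_ord_inj) /= big_ord_recr /= addrC.
congr (_ + _).
  by rewrite /F subnn derivn0 expr0 invr1 mulr1 scale1r.
apply: eq_bigr => h _.
have hk : (h < k)%N by [].
rewrite /F subSS derivnXn subKn 1?ltnW // -scaler_nat scalerA; congr (_ *: _).
rewrite -subSn 1?ltnW // natrM.
have e : ((k ^_ (k - h))%:R : R) = k`!%:R / h`!%:R.
  apply: (canRL (mulfK _)); first by rewrite pnatr_eq0 -lt0n fact_gt0.
  by rewrite -natrM -(ffact_fact (leq_subr h k)) subKn // ltnW.
have gen (a b c d : R) : a / b * (c / d) = c / (b * d) * a.
  by rewrite invfM; ring.
by rewrite e gen.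
Qed.

(* T_w P = \sum_m w^m / (m+1)! P^(m), the mean of P(X + t) over t in [0, w]. *)
Definition Tpoly (w : R) (p : {poly R}) : {poly R} :=
  \sum_(m < n.+1) (w ^+ m / (m.+1`!)%:R) *: derivn m p.

Lemma TmonoE' (w : R) (P : polyn) :
  \sum_(k < n.+1) P`_k *: Tmono w k = Tpoly w P.
Proof.
transitivity (\sum_(k < n.+1) \sum_(m < n.+1)
    P`_k *: ((w ^+ m / (m.+1`!)%:R) *: derivn m ('X^k : {poly R}))).
  apply: eq_bigr => k _; rewrite TmonoE; first by rewrite scaler_sumr.
  by rewrite -ltnS ltn_ord.
rewrite exchange_big /=; apply: eq_bigr => m _.
have {2}-> : (P : {poly R}) = \sum_(k < n.+1) P`_k *: 'X^k.
  by rewrite -poly_def; apply/polyP => i; rewrite coef_poly; case: ltnP => // /big_coef_npoly ->.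
rewrite raddf_sum scaler_sumr; apply: eq_bigr => k _.
by rewrite /= derivnZ !scalerA mulrC.
Qed.

Lemma size_derivn_le (m : nat) (p : {poly R}) : (size (derivn m p) <= size p - m)%N.
Proof.
by apply/leq_sizeP => j; rewrite leq_subLR => h; rewrite coef_derivn nth_default ?mul0rn.
Qed.

Lemma size_Tpoly_sub (w : R) (p : {poly R}) : p != 0 ->
  (size (Tpoly w p - p)%R < size p)%N.
Proof.
move=> p0; rewrite /Tpoly big_ord_recl ?derivn0 expr0 [X in X%:R]/= divr1 scale1r addrC addKr.
have sp : (0 < size p)%N by rewrite lt0n size_poly_eq0.
rewrite -(prednK sp) ltnS; apply/leq_sizeP => j hj.
rewrite coef_sum big1 // => i _; rewrite coefZ nth_default ?mulr0 //.
apply: leq_trans (size_derivn_le _ _) _; apply: leq_trans hj.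
by rewrite /= /bump /= add1n subnS -!subn1 leq_sub2r // leq_subr.
Qed.

Lemma Tpoly_inj (w : R) (p : {poly R}) : Tpoly w p = 0 -> p = 0.
Proof.
move=> Tp; apply/eqP/negPn/negP => p0.
by have := size_Tpoly_sub w p0; rewrite Tp sub0r size_polyN ltnn.
Qed.

Lemma size_Tpoly (w : R) (P : polyn) : (size (Tpoly w P) <= n.+1)%N.
Proof.
apply: (leq_trans (size_sum _ _ _)); apply/bigmax_leqP => m _.
apply: (leq_trans (size_scale_leq _ _)); apply: (leq_trans (size_derivn_le _ _)).
by apply: leq_trans (leq_subr _ _) (size_npoly _).
Qed.

Lemma TfunE (w : R) (P : polyn) : (Tfun w P : {poly R}) = Tpoly w P.
Proof. by rewrite /Tfun TmonoE' npolypK // size_Tpoly. Qed.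

Lemma Tfun_linear (w : R) : linear (Tfun w).
Proof.
move=> c P Q; apply/val_inj; rewrite /= TfunE /= !TfunE /Tpoly.
rewrite scaler_sumr -big_split /=; apply: eq_bigr => m _.
by rewrite derivnD derivnZ scalerDr !scalerA mulrC.
Qed.
HB.instance Definition _ (w : R) :=
  GRing.isLinear.Build R polyn polyn *:%R (Tfun w) (Tfun_linear w).

Lemma Sshift_linear (u : R) : linear (Sshift u).
Proof.
by move=> c P Q; apply/val_inj; rewrite /= SshiftE /= !SshiftE comp_polyD comp_polyZ.
Qed.
HB.instance Definition _ (u : R) :=
  GRing.isLinear.Build R polyn polyn *:%R (Sshift u) (Sshift_linear u).

Lemma lker_Tmap (w : R) : lker (Tmap w) == 0%VS.
Proof.
apply/lker0P => P Q; rewrite !lfunE /= => /eqP; rewrite -subr_eq0 -linearB /=.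
move=> /eqP PQ; apply/eqP; rewrite -subr_eq0; apply/eqP/val_inj => /=.
by apply: (@Tpoly_inj w); have := TfunE w (P - Q); rewrite PQ.
Qed.

Lemma TmapK (w : R) : cancel (Tmap w) (Tmap w)^-1%VF.
Proof. exact: lker0_lfunK (lker_Tmap w). Qed.

Lemma TmapVK (w : R) : cancel (Tmap w)^-1%VF (Tmap w).
Proof. exact: lker0_lfunVK (lker_Tmap w). Qed.

Lemma SshiftC (u w : R) (P : polyn) :
  Tmap w (Sshift u P) = Sshift u (Tmap w P).
Proof.
apply/val_inj; rewrite /= !lfunE /= SshiftE !TfunE SshiftE /Tpoly raddf_sum /=.
apply: eq_bigr => m _; rewrite comp_polyZ; congr (_ *: _).
elim: (nat_of_ord m) => [|i IH]; first by rewrite !derivn0.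
by rewrite !derivnS IH deriv_comp derivD derivX derivC addr0 mulr1.
Qed.

Lemma SshiftD (u v : R) (P : polyn) :
  Sshift (u + v) P = Sshift u (Sshift v P).
Proof.
apply/val_inj; rewrite /= !SshiftE -comp_polyA; congr (_ \Po _).
by rewrite comp_polyD comp_polyX comp_polyC polyCD addrA.
Qed.

Lemma Sshift0 (P : polyn) : Sshift 0 P = P.
Proof. by apply/val_inj; rewrite /= SshiftE polyC0 addr0 comp_polyXr. Qed.

(* The symbol e^{l_0(u, P)}. *)
Definition expl0 (u : R) (P : polyn) : heis := (u, P).

Definition heis_mul (x y : heis) : heis :=
  expl0 (x.1 + y.1)
    ((Tmap (x.1 + y.1))^-1%VF (Tmap x.1 x.2 + Tmap y.1 (Sshift x.1 y.2))).

Definition heis_inv (x : heis) : heis :=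
  expl0 (- x.1) (- Sshift (- x.1) ((Tmap (- x.1))^-1%VF (Tmap x.1 x.2))).

Definition heis_one : heis := expl0 0 0.

Lemma heis_mulA : associative heis_mul.
Proof.
move=> [u P] [v Q] [w K]; rewrite /heis_mul /expl0 /= addrA; congr (_, _ _).
rewrite !TmapVK [Tmap (v + w) _]SshiftC TmapVK linearD /= addrA.
by rewrite -!SshiftC SshiftD.
Qed.

Lemma heis_mul1 : left_id heis_one heis_mul.
Proof.
by move=> [u P]; rewrite /heis_mul /expl0 /= add0r linear0 add0r Sshift0 TmapK.
Qed.

Lemma heis_mul1r : right_id heis_one heis_mul.
Proof.
by move=> [u P]; rewrite /heis_mul /expl0 /= addr0 !linear0 addr0 TmapK.
Qed.

Lemma heis_mulVr : right_inverse heis_one heis_inv heis_mul.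
Proof.
move=> [u P]; rewrite /heis_mul /heis_inv /expl0 /= subrr linearN /=.
by rewrite -SshiftD subrr Sshift0 linearN /= TmapVK subrr linear0.
Qed.

Lemma heis_mulV : left_inverse heis_one heis_inv heis_mul.
Proof.
move=> [u P]; rewrite /heis_mul /heis_inv /expl0 /= addNr linearN /= !SshiftC.
by rewrite TmapVK -SshiftC addNr linear0.
Qed.

HB.instance Definition _ := isGroup.Build heis
  heis_mulA heis_mul1 heis_mul1r heis_mulV heis_mulVr.
End Heis.

From mathcomp Require Import generic_quotient finmap complex.
From mathcomp Require Import all_classical all_reals all_analysis.
Import numFieldNormedType.Exports.
Local Open Scope classical_set_scope.
Local Open Scope quotient_scope.
Local Open Scope ring_scope.

Definition seq_complete (R : realType) (V : zmodType) (N : V -> R) : Prop :=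
  forall v : nat -> V,
    (forall e : R, 0 < e -> exists m : nat, forall p q : nat,
       (m <= p)%N -> (m <= q)%N -> N (v p - v q) < e) ->
    exists l : V, forall e : R, 0 < e ->
      exists m : nat, forall p : nat, (m <= p)%N -> N (v p - l) < e.

(* Unital C*-algebras.  The hierarchy has no join of rings and normed modules
   below numDomainType, so the norm is a separate, real-valued, operation. *)
HB.mixin Record isCStar (R : realType) A of GRing.Algebra R[i] A := {
  cnorm : A -> R;
  star : A -> A;
  cnorm_eq0 : forall x : A, cnorm x = 0 -> x = 0;
  cnormD : forall x y : A, cnorm (x + y) <= cnorm x + cnorm y;
  cnormZ : forall (c : R[i]) (x : A),
    cnorm (c *: x) = complex.Re `|c| * cnorm x;
  cnormM : forall x y : A, cnorm (x * y) <= cnorm x * cnorm y;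
  cnorm_complete : seq_complete cnorm;
  starD : forall x y : A, star (x + y) = star x + star y;
  starZ : forall (c : R[i]) (x : A), star (c *: x) = conjc c *: star x;
  starM : forall x y : A, star (x * y) = star y * star x;
  starK : involutive star;
  cnorm_star_mul : forall x : A, cnorm (star x * x) = cnorm x ^+ 2
}.

#[short(type="cstarType")]
HB.structure Definition CStar (R : realType) :=
  {A of GRing.Algebra R[i] A & isCStar R A}.

Record starHom (R : realType) (A B : cstarType R) := StarHom {
  star_hom :> {lrmorphism A -> B};
  star_homS : forall x : A, star_hom (star x) = star (star_hom x)
}.

Record starIso (R : realType) (A B : cstarType R) := StarIso {
  star_iso :> starHom A B;
  star_isoV : starHom B A;
  star_isoK : cancel star_iso star_isoV;
  star_isoVK : cancel star_isoV star_iso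
}.

Lemma star_compS (R : realType) (A B C : cstarType R)
    (g : starHom B C) (f : starHom A B) (x : A) :
  (g \o f) (star x) = star ((g \o f) x).
Proof. by rewrite /= !star_homS. Qed.

Definition star_comp (R : realType) (A B C : cstarType R)
    (g : starHom B C) (f : starHom A B) : starHom A C :=
  @StarHom R A C (g \o f) (star_compS g f).

HB.mixin Record isHilbert (R : realType) H of GRing.Lmodule R[i] H := {
  hdot : H -> H -> R[i];
  hdot_linear : forall (c : R[i]) (x y z : H),
    hdot (c *: x + y) z = c * hdot x z + hdot y z;
  hdotC : forall x y : H, hdot y x = conjc (hdot x y);
  hdot_ge0 : forall x : H, 0 <= hdot x x;
  hdot_eq0 : forall x : H, hdot x x = 0 -> x = 0;
  hdot_complete :
    seq_complete (fun x : H => Num.sqrt (complex.Re (hdot x x)))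
}.

#[short(type="hilbertType")]
HB.structure Definition Hilbert (R : realType) :=
  {H of GRing.Lmodule R[i] H & isHilbert R H}.

Definition hnorm (R : realType) (H : hilbertType R) (x : H) : R :=
  Num.sqrt (complex.Re (hdot x x)).

Definition opnorm (R : realType) (H : hilbertType R) (T : H -> H) : R :=
  sup [set hnorm (T x) | x in [set x | hnorm x <= 1]].

(* A *-representation of the *-algebra with basis (W_g), given by its values
   [grep g] on the basis; it may be degenerate. *)
Record groupRep (R : realType) (G : groupType) (H : hilbertType R) :=
  GroupRep {
    grep : G -> {linear H -> H};
    grep_bounded : forall g, exists M : R, forall x : H,
      hnorm (grep g x) <= M * hnorm x;
    grepM : forall g h x, grep (g * h)%g x = grep g (grep h x);
    grepV : forall g x y, hdot (grep g x) y = hdot x (grep (g^-1)%g y)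
  }.

(* A list of pairs (c, g) stands for the element \sum c W_g. *)
Definition group_univ_norm (R : realType) (G : groupType)
    (x : seq (R[i] * G)) : R :=
  sup [set r | exists (H : hilbertType R) (U : groupRep G H),
    r = opnorm (fun v : H => \sum_(p <- x) p.1 *: grep U p.2 v)].

(* The free group-C*-algebra: a completion of the *-algebra with basis (W_g). *)
Record groupCstar (R : realType) (G : groupType) := GroupCstar {
  gcs :> cstarType R;
  gW : G -> gcs;
  gW1 : gW 1%g = 1;
  gWM : forall g h, gW (g * h)%g = gW g * gW h;
  gWV : forall g, gW (g^-1)%g = star (gW g);
  gW_norm : forall x : seq (R[i] * G),
    cnorm (\sum_(p <- x) p.1 *: gW p.2) = group_univ_norm x;
  gW_dense : forall (a : gcs) (e : R), 0 < e ->
    exists x : seq (R[i] * G), cnorm (a - \sum_(p <- x) p.1 *: gW p.2) < e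
}.

Definition multilinear (R : realType) (J : finType) (A : J -> cstarType R)
    (V : lmodType R[i]) (f : (forall j, A j) -> V) : Prop :=
  forall (a : forall j, A j) (i : J) (c : R[i]) (x y : A i),
    f (eqtype.dfwith (T := fun j => A j) a (c *: x + y)) =
    c *: f (eqtype.dfwith (T := fun j => A j) a x)
    + f (eqtype.dfwith (T := fun j => A j) a y).

(* Tensor products of finite families, for a fixed C*-cross norm: [tobj A] is
   the completion, for that norm, of the algebraic tensor product of the A_j,
   which is the span of the elementary tensors [tens a].  [tens_univ] is the
   universal property of the algebraic tensor product: the span of the [tens a]
   satisfies no relations besides those holding for every multilinear map.
   [thom] and [tassoc] say that tensor products of *-homomorphisms extend to the
   completions, and that iterated tensor products are identified with tensor
   products over the disjoint union of the index sets (here the fibres of f). *)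
Record cstarTensor (R : realType) := CstarTensor {
  tobj : forall J : finType, (J -> cstarType R) -> cstarType R;
  tens : forall (J : finType) (A : J -> cstarType R),
    (forall j, A j) -> tobj A;
  tens_multilinear : forall (J : finType) (A : J -> cstarType R),
    multilinear (@tens J A);
  tens_univ : forall (J : finType) (A : J -> cstarType R) (V : lmodType R[i])
      (f : (forall j, A j) -> V), multilinear f ->
    forall x : seq (R[i] * (forall j, A j)),
      \sum_(p <- x) p.1 *: tens p.2 = 0 -> \sum_(p <- x) p.1 *: f p.2 = 0;
  tens1 : forall (J : finType) (A : J -> cstarType R),
    tens (fun j => 1 : A j) = 1;
  tensM : forall (J : finType) (A : J -> cstarType R) (a b : forall j, A j),
    tens (fun j => a j * b j) = tens a * tens b;
  tens_star : forall (J : finType) (A : J -> cstarType R) (a : forall j, A j),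
    tens (fun j => star (a j)) = star (tens a);
  tens_cross : forall (J : finType) (A : J -> cstarType R) (a : forall j, A j),
    cnorm (tens a) = \prod_(j : J) cnorm (a j);
  tens_dense : forall (J : finType) (A : J -> cstarType R) (t : tobj A) (e : R),
    0 < e -> exists x : seq (R[i] * (forall j, A j)),
      cnorm (t - \sum_(p <- x) p.1 *: tens p.2) < e;
  thom : forall (J : finType) (A B : J -> cstarType R),
    (forall j, starHom (A j) (B j)) -> starHom (tobj A) (tobj B);
  thomE : forall (J : finType) (A B : J -> cstarType R)
      (f : forall j, starHom (A j) (B j)) (a : forall j, A j),
    thom f (tens a) = tens (fun j => f j (a j));
  tassoc : forall (J K : finType) (f : K -> J) (A : K -> cstarType R),
    starIso
      (tobj (fun j : J => tobj (fun k : {k : K | f k == j} => A (val k))))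
      (tobj A);
  tassocE : forall (J K : finType) (f : K -> J) (A : K -> cstarType R)
      (a : forall k, A k),
    tassoc f A (tens (fun j : J => tens (fun k : {k : K | f k == j} =>
      a (val k)))) = tens a
}.

Record borelSet (R : realType) := BorelSet {
  borel_set :> set R;
  borel_bounded : bounded_set borel_set;
  borel_measurable : measurable borel_set;
  borel_gt0 : (0 < lebesgue_measure borel_set)%E
}.

HB.instance Definition _ (R : realType) := gen_eqMixin (borelSet R).
HB.instance Definition _ (R : realType) := gen_choiceMixin (borelSet R).

Definition ae_sub (R : realType) (A B : set R) : Prop :=
  lebesgue_measure (A `\` B) = 0%E.

Definition ae_eq_set (R : realType) (A B : set R) : Prop :=
  ae_sub A B /\ ae_sub B A.

Definition borel_eq (R : realType) (A B : borelSet R) : bool :=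
  `[< ae_eq_set A B >].

Lemma ae_sub_refl (R : realType) (A : set R) : ae_sub A A.
Proof. by rewrite /ae_sub setDv measure0. Qed.

Lemma ae_sub_trans (R : realType) (A B C : borelSet R) :
  ae_sub A B -> ae_sub B C -> ae_sub A C.
Proof.
rewrite /ae_sub => AB BC.
have mA := borel_measurable A; have mB := borel_measurable B.
have mC := borel_measurable C.
apply/eqP; rewrite eq_le measure_ge0 andbT.
apply: (@le_trans _ _ (lebesgue_measure ((A `\` B) `|` (B `\` C)))).
  apply: le_measure; rewrite ?inE; [exact: measurableD| |].
    by apply: measurableU; exact: measurableD.
  move=> x [Ax nCx]; have [Bx|nBx] := pselect ((B : set R) x).
    by right.
  by left.
apply: (le_trans (measureU2 _ _ _)); [exact: measurableD..|].
have AB0 : (lebesgue_measure ((A : set R) `\` B) <= 0)%E by rewrite AB.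
have BC0 : (lebesgue_measure ((B : set R) `\` C) <= 0)%E by rewrite BC.
by apply: (le_trans (leeD AB0 BC0)); rewrite adde0.
Qed.

Lemma borel_eq_refl (R : realType) : reflexive (@borel_eq R).
Proof. by move=> A; apply/asboolP; split; exact: ae_sub_refl. Qed.

Lemma borel_eq_sym (R : realType) : symmetric (@borel_eq R).
Proof. by move=> A B; apply/asboolP/asboolP => -[]. Qed.

Lemma borel_eq_trans (R : realType) : transitive (@borel_eq R).
Proof.
move=> B A C /asboolP[AB BA] /asboolP[BC CB]; apply/asboolP; split.
  exact: ae_sub_trans AB BC.
exact: ae_sub_trans CB BA.
Qed.

Canonical borel_equiv (R : realType) :=
  EquivRel (@borel_eq R) (@borel_eq_refl R) (@borel_eq_sym R)
    (@borel_eq_trans R).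

Definition borelQ (R : realType) : Type := {eq_quot (@borel_equiv R)}%qT.
Definition bset (R : realType) (I : borelQ R) : borelSet R := repr I.

Definition bsize (R : realType) (I : borelQ R) : R :=
  fine (lebesgue_measure (bset I : set R)).

Lemma bsize_gt0 (R : realType) (I : borelQ R) : 0 < bsize I.
Proof.
rewrite /bsize; case: (bset I) => A /= [M [_ bA]] mA A0.
apply: fine_gt0; rewrite A0 /=.
have AM : A `<=` `[- (`|M| + 1), `|M| + 1]%classic.
  move=> x Ax /=; rewrite in_itv /= -ler_norml.
  by apply: bA => //; rewrite (le_lt_trans (ler_norm _)) // ltrDl.
apply: (@le_lt_trans _ _ (lebesgue_measure `[- (`|M| + 1), `|M| + 1]%classic)).
  by apply: le_measure; rewrite ?inE.
by rewrite lebesgue_measure_itv /=; case: ifP => _; rewrite ?ltry // -EFinD ltry.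
Qed.

Record borelPartition (R : realType) (I : borelQ R) := BorelPartition {
  cells :> {fset borelQ R};
  cells_disjoint : forall J K : borelQ R, J \in cells -> K \in cells ->
    J != K -> lebesgue_measure ((bset J : set R) `&` bset K) = 0%E;
  cells_cover :
    ae_eq_set (\bigcup_(J in [set` cells]) (bset J : set R)) (bset I)
}.

Lemma trivial_disjoint (R : realType) (I J K : borelQ R) :
  J \in [fset I]%fset -> K \in [fset I]%fset -> J != K ->
  lebesgue_measure ((bset J : set R) `&` bset K) = 0%E.
Proof. by move=> /fset1P-> /fset1P->; rewrite eqxx. Qed.

Lemma trivial_cover (R : realType) (I : borelQ R) :
  ae_eq_set (\bigcup_(J in [set` [fset I]%fset]) (bset J : set R)) (bset I).
Proof.
have -> : \bigcup_(J in [set` [fset I]%fset]) (bset J : set R) = bset I.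
  apply/seteqP; split => [x [J /= /fset1P->] //|x Ix].
  by exists I => //=; exact/fset1P.
by split; exact: ae_sub_refl.
Qed.

Definition trivial_partition (R : realType) (I : borelQ R) : borelPartition I :=
  BorelPartition (@trivial_disjoint R I) (trivial_cover I).

(* [refines p q] reads p \prec q. *)
Definition refines (R : realType) (I : borelQ R) (p q : borelPartition I) :
    Prop :=
  forall k : q, exists j : p, ae_sub (bset (val k)) (bset (val j)).

(* The cell of p containing a cell of q, which is unique because cells have
   positive measure. *)
Definition parent (R : realType) (I : borelQ R) (p q : borelPartition I)
    (pq : refines p q) (k : q) : p := projT1 (cid (pq k)).

Definition heisI (R : realType) (n : nat) (I : borelQ R) : Type :=
  (R * {poly_n.+1 R})%type.
HB.instance Definition _ (R : realType) (n : nat) (I : borelQ R) :=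
  gen_eqMixin (heisI n I).
HB.instance Definition _ (R : realType) (n : nat) (I : borelQ R) :=
  gen_choiceMixin (heisI n I).

Section HeisI.
Variables (R : realType) (n : nat) (I : borelQ R).
Notation polyn := {poly_n.+1 R}.
Notation heisI := (heisI n I).

(* The symbol e^{l_I(u, P)}. *)
Definition explI (u : R) (P : polyn) : heisI := (u, P).

Definition khat (x : heisI) : heis R n :=
  expl0 (x.1 * bsize I `^ 2^-1)
    (mk_npoly n.+1 (fun j => x.2`_j * bsize I `^ (1 - j%:R / 2))).

Definition khatV (x : heis R n) : heisI :=
  explI (x.1 / bsize I `^ 2^-1)
    (mk_npoly n.+1 (fun j => x.2`_j / bsize I `^ (1 - j%:R / 2))).

Lemma bsize_pow_neq0 (r : R) : bsize I `^ r != 0.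
Proof. by rewrite gt_eqF // powR_gt0 // bsize_gt0. Qed.

Lemma khatK : cancel khat khatV.
Proof.
move=> [u P]; rewrite /khat /khatV /explI /= mulfK ?bsize_pow_neq0 //.
congr (_, _); apply/npolyP => j; rewrite /= !coef_poly.
case: ltnP => [jn|/big_coef_npoly-> //]; rewrite mulfK ?bsize_pow_neq0 //.
Qed.

Lemma khatVK : cancel khatV khat.
Proof.
move=> [u P]; rewrite /khat /khatV /expl0 /= divfK ?bsize_pow_neq0 //.
congr (_, _); apply/npolyP => j; rewrite /= !coef_poly.
case: ltnP => [jn|/big_coef_npoly-> //]; rewrite divfK ?bsize_pow_neq0 //.
Qed.

Definition heisI_mul (x y : heisI) : heisI := khatV (khat x * khat y)%g.
Definition heisI_inv (x : heisI) : heisI := khatV (khat x)^-1%g.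
Definition heisI_one : heisI := khatV 1%g.

Lemma heisI_mulA : associative heisI_mul.
Proof. by move=> x y z; rewrite /heisI_mul !khatVK mulgA. Qed.

Lemma heisI_mul1 : left_id heisI_one heisI_mul.
Proof. by move=> x; rewrite /heisI_mul khatVK mul1g khatK. Qed.

Lemma heisI_mul1r : right_id heisI_one heisI_mul.
Proof. by move=> x; rewrite /heisI_mul khatVK mulg1 khatK. Qed.

Lemma heisI_mulV : left_inverse heisI_one heisI_inv heisI_mul.
Proof. by move=> x; rewrite /heisI_mul khatVK mulVg. Qed.

Lemma heisI_mulVr : right_inverse heisI_one heisI_inv heisI_mul.
Proof. by move=> x; rewrite /heisI_mul khatVK mulgV. Qed.

HB.instance Definition _ := isGroup.Build heisI
  heisI_mulA heisI_mul1 heisI_mul1r heisI_mulV heisI_mulVr.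

End HeisI.

(* The free group-C*-algebras together with the *-homomorphisms that are
   determined by their values on the generators: [hs I] is s_I, and
   [hdiag J I] is the *-homomorphism \bigotimes^(diag)_j s_{I_j}^{-1}. *)
Record heisData (R : realType) (n : nat) (T : cstarTensor R) := HeisData {
  W0 : groupCstar R (heis R n);
  W0I : forall I : borelQ R, groupCstar R (heisI n I);
  hs : forall I : borelQ R, starIso (W0I I) W0;
  hsE : forall (I : borelQ R) (u : R) (P : {poly_n.+1 R}),
    hs I (gW (W0I I) (explI I u P)) = gW W0 (expl0 u P);
  hdiag : forall (J : finType) (I : J -> borelQ R),
    starHom W0 (tobj T (fun j => gcs (W0I (I j))));
  hdiagE : forall (J : finType) (I : J -> borelQ R)
      (u : R) (P : {poly_n.+1 R}),
    hdiag I (gW W0 (expl0 u P)) =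
    tens T (fun j => star_isoV (hs (I j)) (gW W0 (expl0 u P)))
}.

Section Limit.
Variables (R : realType) (n : nat) (T : cstarTensor R) (D : heisData n T).

(* W^0_{1,n;I;p} *)
Definition Wpart (I : borelQ R) (p : borelPartition I) : cstarType R :=
  tobj T (fun j : p => gcs (W0I D (val j))).

(* z_{I;p,q} *)
Definition zmap (I : borelQ R) (p q : borelPartition I) (pq : refines p q) :
    starHom (Wpart p) (Wpart q) :=
  star_comp (tassoc T (parent pq) (fun k : q => gcs (W0I D (val k))))
    (thom T (fun j : p =>
      star_comp
        (hdiag D (fun k : {k : q | parent pq k == j} => val (val k)))
        (hs D (val j)))).

(* The C*-inductive limit of the system [zmap]: the completion of the union of
   the increasing family of the Wpart p. *)
Record heisLimit (I : borelQ R) := HeisLimit {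
  Wlim :> cstarType R;
  zlim : forall p : borelPartition I, starHom (Wpart p) Wlim;
  zlim_norm : forall (p : borelPartition I) (x : Wpart p),
    cnorm (zlim p x) = cnorm x;
  zlim_compat : forall (p q : borelPartition I) (pq : refines p q)
      (x : Wpart p), zlim q (zmap pq x) = zlim p x;
  zlim_dense : forall (a : Wlim) (e : R), 0 < e ->
    exists (p : borelPartition I) (x : Wpart p), cnorm (a - zlim p x) < e
}.

(* W_I(u, P); the one-fold tensor product over the partition {I} of I is
   identified with its factor. *)
Definition WI (I : borelQ R) (L : heisLimit I) (u : R) (P : {poly_n.+1 R}) :
    L :=
  zlim L (trivial_partition I)
    (tens T (fun j : trivial_partition I =>
       gW (W0I D (val j)) (explI (val j) u P))).

End Limit.

(* Main.v *)
Require Import Defs.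
From HB Require Import structures.
From mathcomp Require Import all_boot all_order all_algebra finmap complex ring lra.
From mathcomp Require Import all_classical all_reals all_analysis.
Set Implicit Arguments.
Unset Strict Implicit.
Unset Printing Implicit Defensive.
Import Order.TTheory GRing.Theory Num.Theory numFieldNormedType.Exports.
Local Open Scope ring_scope.

(** Let [q] be a refinement of the partition [p] of [I], and let [q_j] be the
    partition of the cell [I_j] of [p] formed by the cells of [q] inside [I_j].
    Sorting the cells of [q] by the cell of [p] that contains them turns
    [W^0_{I;q}] into the tensor product over [j] of the [W^0_{I_j;q_j}], which
    maps to the tensor product of the limits [W_{I_j}].  Call the composite
    [split_hom].  It is compatible with refinement of [q], its ranges together
    are dense, and it is isometric, so it extends to an isomorphism from [W_I]
    onto the tensor product of the [W_{I_j}] ([factorization]), whose inverse is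
    [u_{I,p}].
    The operator [W_I(u, P)] comes from a tensor product of generators over any
    partition, in particular over [p] itself, and [split_hom] takes tensor
    products of generators to elementary tensors ([split_hom_gen]); this is the
    second claim.

    The isometry is the crux.  It would be automatic for the minimal cross norm,
    but the given norm is only known to be functorial, and a tensor product of
    isometric embeddings need not be isometric (the maximal norm is an example).
    Functoriality does preserve left inverses, and a homomorphism with a left
    inverse homomorphism is isometric, because homomorphisms are contractive.
    So the embeddings of [W^0_{I;q}] into [W_I] are shown to split.  A map
    [f : K -> J] of index sets gives a homomorphism, contravariantly and
    functorially, from the tensor product over [J] to the one over [K] which
    turns the tensor product of the generators with coordinates
    [x : J -> R * {poly_n.+1 R}] into the one with coordinates [x \o f]
    ([pullback]).  The connecting maps of the inductive system are the pullbacks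
    along [parent]; a pullback along a section of [parent] keeps one chosen cell
    inside each coarse cell and applies the trivial representation to the other
    factors.  Choosing the cells consistently for all partitions at once takes
    an ultrafilter for each coarse cell [k], containing the sets that are conull
    in [k]: exactly one cell of every partition of [I] belongs to it.  The
    resulting pullbacks are compatible with refinement and glue to a left
    inverse on the limit ([zlim_retraction]).

    Contractivity of homomorphisms ([starHom_contractive]) is derived from the
    C*-identity: a self-adjoint [a] of norm less than 1 is the real part of the
    unitary [a + i sqrt(1 - a^2)], and homomorphisms map unitaries to
    unitaries. *)

(** * Norms and adjoints *)

Section CstarBasics.
Variables (R : realType) (A : cstarType R).
Implicit Types (x y z : A) (r : R).

Lemma cnormZr r x : cnorm ((r%:C)%C *: x) = `|r| * cnorm x.
Proof. by rewrite cnormZ normc_def /= expr0n addr0 sqrtr_sqr. Qed.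

Lemma cnormN x : cnorm (- x) = cnorm x.
Proof. by rewrite -scaleN1r cnormZ normrN1 mul1r. Qed.

Lemma cnorm0 : cnorm (0 : A) = 0.
Proof. by rewrite -(scale0r (0 : A)) cnormZ normr0 mul0r. Qed.

Lemma cnorm_ge0 x : 0 <= cnorm x.
Proof.
have := cnormD x (- x); rewrite subrr cnorm0 cnormN => h; lra.
Qed.

Lemma cdistC x y : cnorm (x - y) = cnorm (y - x).
Proof. by rewrite -cnormN opprB. Qed.

Lemma cdist_tri z x y : cnorm (x - y) <= cnorm (x - z) + cnorm (z - y).
Proof. by apply: le_trans (cnormD _ _); rewrite addrA subrK. Qed.

Lemma star1 : star (1 : A) = 1.
Proof. by have := starM (1 : A) (star 1); rewrite mul1r starK mul1r. Qed.

Lemma star0 : star (0 : A) = 0.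
Proof. by apply: (@addrI _ (star 0)); rewrite -starD !addr0. Qed.

Lemma starN x : star (- x) = - star x.
Proof. by apply/eqP; rewrite -addr_eq0 -starD addNr star0. Qed.

Lemma starZr r x : star ((r%:C)%C *: x) = (r%:C)%C *: star x.
Proof. by rewrite starZ conjc_real. Qed.

Lemma cnorm_star x : cnorm (star x) = cnorm x.
Proof.
have H y : cnorm y <= cnorm (star y).
  have := cnormM (star y) y; rewrite cnorm_star_mul expr2.
  have := cnorm_ge0 y; rewrite le0r => /predU1P[->|y0]; first by rewrite cnorm_ge0.
  by rewrite ler_pM2r.
by apply/eqP; rewrite eq_le H -{2}(starK x) H.
Qed.

Lemma cnorm_unitary x : star x * x = 1 -> cnorm x <= 1.
Proof.
move=> xx.
have H1 : cnorm (1 : A) <= 1.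
  have := cnorm_star_mul (1 : A); rewrite star1 mulr1.
  have := cnorm_ge0 (1 : A); nra.
have := cnorm_star_mul x; rewrite xx => e.
have := cnorm_ge0 x; nra.
Qed.

(** The form in which limit arguments are used: an approximation argument bounds
    the norm by a fixed multiple of the accuracy. *)
Lemma cnorm_small_eq0 (C : R) x :
  (forall e, 0 < e -> e <= 1 -> cnorm x <= C * e) -> x = 0.
Proof.
move=> h; apply: cnorm_eq0; apply/eqP; rewrite eq_le cnorm_ge0 andbT.
rewrite leNgt; apply/negP => x0.
have h1 := h 1 ltr01 (lexx _); rewrite mulr1 in h1.
have C0 : 0 < C by lra.
have e0 : 0 < cnorm x / (2 * C) by rewrite divr_gt0 // mulr_gt0.
have e1 : cnorm x / (2 * C) <= 1 by rewrite ler_pdivrMr ?mulr_gt0//; lra.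
have := h _ e0 e1; rewrite invfM mulrCA [C * (_ * _)]mulrCA divff ?gt_eqF // mulr1; lra.
Qed.

End CstarBasics.

(** * Square roots and contractivity *)

Section SquareRoot.
Variables (R : realType) (A : cstarType R) (a : A).
Hypotheses (aS : star a = a) (a1 : cnorm a < 1).

(* If [y] is fixed by [F] then [1 - y] is a square root of [1 - a^2].  On the
   ball of radius [cnorm a] the map [F] is a contraction of ratio [cnorm a]. *)
Let half : R[i] := (2^-1 : R)%:C%C.
Let F (y : A) : A := half *: (a * a + y * y).
Let y (m : nat) : A := iter m F 0.
Let r := cnorm a.

Let r0 : 0 <= r. Proof. exact: cnorm_ge0. Qed.

Let cnorm_half (z : A) : cnorm (half *: z) = cnorm z / 2.
Proof. by rewrite /half cnormZr mulrC ger0_norm. Qed.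

Let y_le m : cnorm (y m) <= r.
Proof.
elim: m => [|m IH]; first by rewrite /y /= cnorm0.
rewrite /y iterS -/(y m) /F cnorm_half.
have H1 := cnormD (a * a) (y m * y m).
have H2 := cnormM a a; have H3 := cnormM (y m) (y m).
rewrite -/r in H2.
have H4 := cnorm_ge0 (y m).
have H5 : cnorm (y m) * cnorm (y m) <= r * r by nra.
have r1 : r < 1 by [].
have : r * r <= r by nra.
lra.
Qed.

Let F_dist (u v : A) :
  cnorm (F u - F v) <= (cnorm u + cnorm v) / 2 * cnorm (u - v).
Proof.
rewrite /F -scalerBr cnorm_half opprD addrACA subrr add0r.
have -> : u * u - v * v = u * (u - v) + (u - v) * v.
  by rewrite mulrBr mulrBl addrA subrK.
have H1 := cnormD (u * (u - v)) ((u - v) * v).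
have H2 := cnormM u (u - v); have H3 := cnormM (u - v) v.
nra.
Qed.

Let y_cauchy m k : cnorm (y (m + k) - y m) <= r ^+ m.
Proof.
elim: m => [|m IH].
  by rewrite add0n expr0 /= subr0; apply: le_trans (y_le _) (ltW a1).
rewrite addSn /y !iterS -/(y (m + k)) -/(y m) exprS.
apply: le_trans (F_dist _ _) _.
apply: ler_pM => //; first by rewrite divr_ge0 // addr_ge0 // cnorm_ge0.
  exact: cnorm_ge0.
have := y_le (m + k); have := y_le m; lra.
Qed.

(** Self-adjointness and commutation with [a] hold for every iterate of [F], and
    so pass to the fixed point. *)
Lemma sqrt_one_sub_sqr :
  exists c : A, [/\ star c = c, a * c = c * a & a * a + c * c = 1].
Proof.
have [l Hl] : exists l : A, forall e : R, 0 < e ->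
    exists m : nat, forall p : nat, (m <= p)%N -> cnorm (y p - l) < e.
  apply: cnorm_complete => e e0.
  have : ((fun n => r ^+ n) @ \oo --> (0 : R))%classic by apply: cvg_expr; rewrite ger0_norm.
  move=> /cvgrPdist_lt /(_ (e / 2)); rewrite divr_gt0 // => /(_ isT) [N _ HN].
  exists N => p q Np Nq.
  have H k : (N <= k)%N -> cnorm (y k - y N) < e / 2.
    move=> Nk; rewrite -(subnKC Nk); apply: le_lt_trans (y_cauchy _ _) _.
    have := HN N (leqnn N); rewrite /= sub0r normrN ger0_norm // exprn_ge0 //.
  apply: le_lt_trans (cdist_tri (y N) _ _) _.
  rewrite [X in _ + X]cdistC.
  have := H _ Np; have := H _ Nq; lra.
have near e : 0 < e -> exists m, cnorm (y m - l) < e /\ cnorm (y m.+1 - l) < e.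
  by move=> e0; have [m Hm] := Hl e e0; exists m; split; apply: Hm.
have yS m : star (y m) = y m.
  elim: m => [|m IH]; first exact: star0.
  rewrite /y iterS -/(y m) /F starZr starD !starM aS IH //.
have yC m : a * y m = y m * a.
  elim: m => [|m IH]; first by rewrite mulr0 mul0r.
  rewrite /y iterS -/(y m) /F -scalerAl -scalerAr mulrDl mulrDr !mulrA.
  by rewrite IH -!mulrA IH !mulrA.
have lS : star l = l.
  apply/eqP; rewrite -subr_eq0; apply/eqP.
  apply: (@cnorm_small_eq0 _ _ 2) => e e0 _; have [m [Hm _]] := near e e0.
  have E : cnorm (star l - y m) = cnorm (y m - l).
    by rewrite -{1}(yS m) -starN -starD cnorm_star cdistC.
  have := cdist_tri (y m) (star l) l; rewrite E; lra.
have lC : a * l = l * a.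
  apply/eqP; rewrite -subr_eq0; apply/eqP.
  apply: (@cnorm_small_eq0 _ _ 2) => e e0 _; have [m [Hm _]] := near e e0.
  have -> : a * l - l * a = a * (l - y m) + (y m - l) * a.
    by rewrite mulrBr mulrBl yC addrA subrK.
  have := cnormD (a * (l - y m)) ((y m - l) * a).
  have := cnormM a (l - y m); have := cnormM (y m - l) a.
  rewrite [cnorm (l - _)]cdistC -/r.
  have := cnorm_ge0 (y m - l).
  have r1 : r < 1 by [].
  nra.
have lF : F l = l.
  apply/eqP; rewrite -subr_eq0; apply/eqP.
  apply: (@cnorm_small_eq0 _ _ (2 + cnorm l)) => e e0 e1.
  have [m [Hm Hm1]] := near e e0.
  have := cdist_tri (y m.+1) (F l) l.
  rewrite {1}/y iterS -/(y m) => H.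
  have := F_dist l (y m); rewrite [cnorm (l - _)]cdistC => H1.
  have H2 := y_le m.
  have H3 := cnorm_ge0 l; have H4 := cnorm_ge0 (y m); have H5 := cnorm_ge0 (y m - l).
  have r1 : r < 1 by [].
  have H6 : (cnorm l + cnorm (y m)) / 2 * cnorm (y m - l) <=
     (cnorm l + 1) * e.
    by apply: ler_pM => //; lra.
  nra.
have l2 : a * a + l * l = l + l.
  have : F l + F l = l + l by rewrite lF.
  rewrite -{1 2}[F l]scale1r -scalerDl /F scalerA => <-.
  have -> : (1 + 1) * half = 1.
    rewrite /half -[1 + 1]/(2%:R : R[i]).
    rewrite -(rmorph_nat (real_complex R)) -rmorphM /= mulfV ?rmorph1 //.
  by rewrite scale1r.
exists (1 - l); split.
- by rewrite starD starN star1 lS.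
- by rewrite mulrBr mulrBl mulr1 mul1r lC.
have -> : a * a = l + l - l * l by rewrite -l2 addrK.
rewrite mulrBr mulr1 mulrBl mul1r opprB addrC -[1 - l + _]addrA.
by rewrite [- l + _]addrCA -opprD -addrA [X in 1 + X]addrA subrK subrr addr0.
Qed.

End SquareRoot.

Section Contractive.
Variables (R : realType) (A B : cstarType R) (f : starHom A B).

Let contractive_selfadjoint (a : A) :
  star a = a -> cnorm a < 1 -> cnorm (f a) <= 1.
Proof.
move=> aS a1; have [c [cS ac e]] := sqrt_one_sub_sqr aS a1.
pose u : A := a + 'i%C *: c.
have uS : star u = a - 'i%C *: c.
  rewrite starD starZ aS cS -scaleNr; congr (_ + _ *: _).
  by apply/eqP; rewrite eq_complex /= oppr0 !eqxx.
have ii : 'i%C * 'i%C = -1 :> R[i] by rewrite -expr2 sqr_i.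
have uu : star u * u = 1.
  rewrite uS /u mulrBl !mulrDr -!scalerAr -!scalerAl -ac scalerA ii.
  by rewrite opprD addrA addrK scaleN1r opprK.
have uu' : u * star u = 1.
  rewrite uS /u mulrBr !mulrDl -!scalerAr -!scalerAl -ac scalerA ii.
  by rewrite opprD addrA addrK scaleN1r opprK.
have fu : cnorm (f u) <= 1.
  by apply: cnorm_unitary; rewrite -star_homS -rmorphM uu rmorph1.
have fu' : cnorm (f (star u)) <= 1.
  by rewrite star_homS cnorm_star.
have a2 : a + a = u + star u by rewrite uS /u addrACA subrr addr0.
have : cnorm (f a + f a) <= 2.
  rewrite -rmorphD a2 rmorphD; apply: le_trans (cnormD _ _) _; lra.
have -> : f a + f a = ((2%:R : R)%:C)%C *: f a.
  by rewrite rmorph_nat -[2%:R]/(1 + 1) scalerDl scale1r.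
rewrite cnormZr ger0_norm //; lra.
Qed.

(** By the C*-identity it suffices to treat [star x * x], rescaled to norm less
    than 1; that element is the average of a unitary and its adjoint. *)
Lemma starHom_contractive (x : A) : cnorm (f x) <= cnorm x.
Proof.
rewrite -(@ler_pXn2r _ 2) ?nnegrE ?cnorm_ge0 // -!cnorm_star_mul -star_homS -rmorphM.
set a := star x * x.
have aS : star a = a by rewrite /a starM starK.
apply/ler_addgt0Pr => e e0.
set M := cnorm a + e.
have M0 : 0 < M by rewrite ltr_wpDl ?cnorm_ge0.
have Mn : `|M^-1| = M^-1 by rewrite gtr0_norm ?invr_gt0.
have := @contractive_selfadjoint ((M^-1)%:C%C *: a).
rewrite starZr aS cnormZr linearZ /= cnormZr Mn.
rewrite mulrC ltr_pdivrMr // mul1r ltrDl => /(_ erefl e0).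
by rewrite mulrC ler_pdivrMr // mul1r.
Qed.

End Contractive.

Lemma starHom_isometric (R : realType) (A B : cstarType R) (f : starHom A B)
    (g : starHom B A) : cancel f g -> forall x : A, cnorm (f x) = cnorm x.
Proof.
move=> fK x; apply/eqP; rewrite eq_le starHom_contractive.
by rewrite -{1}(fK x) starHom_contractive.
Qed.

(** * Extension from dense subsets *)

Lemma starHom_eq_dense (R : realType) (A B : cstarType R) (f g : starHom A B)
    (S : A -> Prop) :
  (forall (a : A) (e : R), 0 < e -> exists2 s, S s & cnorm (a - s) < e) ->
  (forall s, S s -> f s = g s) -> forall a : A, f a = g a.
Proof.
move=> Sd fg a; apply/eqP; rewrite -subr_eq0; apply/eqP.
apply: (@cnorm_small_eq0 _ _ 2) => e e0 _; have [s Ss sa] := Sd a e e0.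
have := cdist_tri (f s) (f a) (g a); rewrite {2}(fg s Ss).
rewrite -!rmorphB.
have := starHom_contractive f (a - s); have := starHom_contractive g (s - a).
rewrite (cdistC s a); lra.
Qed.

Definition id_starHom (R : realType) (A : cstarType R) : starHom A A :=
  @StarHom R A A idfun (fun=> erefl).

Lemma star_compE (R : realType) (A B C : cstarType R) (g : starHom B C)
    (f : starHom A B) x : star_comp g f x = g (f x).
Proof. by []. Qed.

Section StarHomBuild.
Variables (R : realType) (A B : cstarType R) (f : A -> B).
Hypotheses (f_lin : linear f) (f1 : f 1 = 1) (fM : {morph f : x y / x * y})
  (fS : forall x, f (star x) = star (f x)).

Let f_mon : monoid_morphism f. Proof. by []. Qed.

HB.instance Definition _ := GRing.isLinear.Build R[i] A B *:%R f f_lin.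
HB.instance Definition _ := GRing.isMonoidMorphism.Build A B f f_mon.

Definition build_starHom : starHom A B := @StarHom R A B f fS.

Lemma build_starHomE x : build_starHom x = f x. Proof. by []. Qed.
End StarHomBuild.

(** Continuity of the operations, stated so that closures of graphs and of ranges
    inherit closedness under them. *)
Lemma lin_close (R : realType) (C : cstarType R) (c : R[i]) (a a' : C) (e : R) :
  0 < e -> exists2 d, 0 < d & forall x x', cnorm (a - x) < d ->
    cnorm (a' - x') < d -> cnorm (c *: a + a' - (c *: x + x')) < e.
Proof.
move=> e0; pose k := complex.Re `|c|.
have k0 : 0 <= k by rewrite /k normc_def /= sqrtr_ge0.
have d0 : 0 < e / (k + 1) by rewrite divr_gt0 // ltr_wpDl.
exists (e / (k + 1)) => // x x' ax ax'.
rewrite opprD addrACA -scalerBr; apply: le_lt_trans (cnormD _ _) _.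
rewrite cnormZ -/k.
have -> : e = k * (e / (k + 1)) + e / (k + 1) by field; lra.
by rewrite ler_ltD // ler_wpM2l // ltW.
Qed.

Lemma mul_close (R : realType) (C : cstarType R) (a a' : C) (e : R) : 0 < e ->
  exists2 d, 0 < d & forall x x', cnorm (a - x) < d -> cnorm (a' - x') < d ->
    cnorm (a * a' - x * x') < e.
Proof.
move=> e0; pose K := cnorm a + cnorm a' + 1.
have na := cnorm_ge0 a; have na' := cnorm_ge0 a'.
have K0 : 0 < K by rewrite /K; lra.
pose d := Num.min 1 (e / K).
have dK : d * K <= e by rewrite -ler_pdivlMr // /d ge_min lexx orbT.
have d1 : d <= 1 by rewrite /d ge_min lexx.
have d0 : 0 < d by rewrite /d lt_min ltr01 divr_gt0.
exists d => // x x' ax ax'.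
have -> : a * a' - x * x' = (a - x) * a' + x * (a' - x').
  by rewrite mulrBl mulrBr addrA subrK.
apply: le_lt_trans (cnormD _ _) _.
have H1 := cnormM (a - x) a'; have H2 := cnormM x (a' - x').
have H3 : cnorm x <= cnorm a + d.
  have := cnormD (x - a) a; rewrite subrK (cdistC x); lra.
have x0 := cnorm_ge0 x; have p0 := cnorm_ge0 (a - x); have q0 := cnorm_ge0 (a' - x').
apply: lt_le_trans dK.
have H4 : cnorm x * cnorm (a' - x') <= (cnorm a + 1) * cnorm (a' - x').
  by rewrite ler_wpM2r //; lra.
have H5 : (cnorm a + 1) * cnorm (a' - x') < (cnorm a + 1) * d.
  by rewrite ltr_pM2l //; lra.
have H6 : cnorm (a - x) * cnorm a' <= d * cnorm a' by rewrite ler_wpM2r // ltW.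
rewrite /K; nra.
Qed.

(** A homomorphism on a dense subset is given by its graph [G].  This spares
    naming the dense subalgebra, and contractivity of [G] together with linearity
    also shows that [G] is single-valued. *)
Section GraphExtension.
Variables (R : realType) (A B : cstarType R) (G : A -> B -> Prop).
Hypotheses
  (G_lin : forall (c : R[i]) a b a' b',
     G a b -> G a' b' -> G (c *: a + a') (c *: b + b'))
  (G_mul : forall a b a' b', G a b -> G a' b' -> G (a * a') (b * b'))
  (G_star : forall a b, G a b -> G (star a) (star b))
  (G_one : G 1 1)
  (G_le : forall a b, G a b -> cnorm b <= cnorm a)
  (G_dense : forall (a : A) (e : R), 0 < e ->
     exists2 p, G p.1 p.2 & cnorm (a - p.1) < e).

(** The closure of [G], which completeness of [B] makes total. *)
Let Gbar a b := forall e, 0 < e ->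
  exists p, [/\ G p.1 p.2, cnorm (a - p.1) < e & cnorm (b - p.2) < e].

Let G_sub a b a' b' : G a b -> G a' b' -> G (a - a') (b - b').
Proof.
by move=> Gab Gab'; have := G_lin (-1) Gab' Gab; rewrite !scaleN1r ![- _ + _]addrC.
Qed.

Let G_Gbar a b : G a b -> Gbar a b.
Proof. by move=> Gab e e0; exists (a, b); rewrite /= !subrr !cnorm0. Qed.

Let Gbar_fun a b b' : Gbar a b -> Gbar a b' -> b = b'.
Proof.
move=> ab ab'; apply/eqP; rewrite -subr_eq0; apply/eqP.
apply: (@cnorm_small_eq0 _ _ 4) => e e0 _.
have [[x y] /= [Gxy ax yb]] := ab e e0; have [[x' y'] /= [Gxy' ax' yb']] := ab' e e0.
have := G_le (G_sub Gxy Gxy').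
have := cdist_tri y b b'; have := cdist_tri y' y b'; have := cdist_tri a x x'.
rewrite (cdistC x a) (cdistC y' b'); lra.
Qed.

Let Gbar_ex a : exists b, Gbar a b.
Proof.
have /choice [s Hs] : forall m : nat, exists p : A * B,
    G p.1 p.2 /\ cnorm (a - p.1) < m.+1%:R^-1.
  by move=> m; have [|p] := G_dense a (e := m.+1%:R^-1); [rewrite invr_gt0|exists p].
have inv e : 0 < e -> exists N, forall m, (N <= m)%N -> (m.+1%:R^-1 : R) < e.
  move=> e0.
  have : ((fun n => n.+1%:R^-1) @ \oo --> (0 : R))%classic by exact: cvg_harmonic.
  move=> /cvgrPdist_lt /(_ e e0) [N _ HN]; exists N => m Nm.
  by have := HN m Nm; rewrite /= sub0r normrN ger0_norm // invr_ge0.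
have [b Hb] : exists l : B, forall e : R, 0 < e ->
    exists m : nat, forall p : nat, (m <= p)%N -> cnorm ((s p).2 - l) < e.
  apply: cnorm_complete => e e0.
  have [|N HN] := inv (e / 2); first by rewrite divr_gt0.
  exists N => p q Np Nq.
  apply: le_lt_trans (G_le (G_sub (Hs p).1 (Hs q).1)) _.
  have := cdist_tri a (s p).1 (s q).1; rewrite (cdistC (s p).1 a).
  have := lt_trans (Hs p).2 (HN p Np); have := lt_trans (Hs q).2 (HN q Nq); lra.
exists b => e e0; have [N HN] := inv e e0; have [M HM] := Hb e e0.
exists (s (maxn N M)); split; first exact: (Hs _).1.
  by apply: lt_trans (Hs _).2 _; apply: HN; exact: leq_maxl.
by rewrite cdistC; apply: HM; exact: leq_maxr.
Qed.

Let Gbar_lin (c : R[i]) a b a' b' :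
  Gbar a b -> Gbar a' b' -> Gbar (c *: a + a') (c *: b + b').
Proof.
move=> ab ab' e e0.
have [d d0 Hd] := lin_close c a a' e0; have [d' d'0 Hd'] := lin_close c b b' e0.
have m0 : 0 < Num.min d d' by rewrite lt_min d0.
have [[x y] /= [Gxy ax yb]] := ab _ m0; have [[x' y'] /= [Gxy' ax' yb']] := ab' _ m0.
move: ax yb ax' yb'; rewrite !lt_min => /andP[? _] /andP[_ ?] /andP[? _] /andP[_ ?].
by exists (c *: x + x', c *: y + y') => /=; split; [exact: G_lin|exact: Hd|exact: Hd'].
Qed.

Let Gbar_mul a b a' b' : Gbar a b -> Gbar a' b' -> Gbar (a * a') (b * b').
Proof.
move=> ab ab' e e0.
have [d d0 Hd] := mul_close a a' e0; have [d' d'0 Hd'] := mul_close b b' e0.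
have m0 : 0 < Num.min d d' by rewrite lt_min d0.
have [[x y] /= [Gxy ax yb]] := ab _ m0; have [[x' y'] /= [Gxy' ax' yb']] := ab' _ m0.
move: ax yb ax' yb'; rewrite !lt_min => /andP[? _] /andP[_ ?] /andP[? _] /andP[_ ?].
by exists (x * x', y * y') => /=; split; [exact: G_mul|exact: Hd|exact: Hd'].
Qed.

Let Gbar_star a b : Gbar a b -> Gbar (star a) (star b).
Proof.
move=> ab e e0; have [[x y] /= [Gxy ax yb]] := ab e e0.
exists (star x, star y) => /=; split; first exact: G_star.
  by rewrite -starN -starD cnorm_star.
by rewrite -starN -starD cnorm_star.
Qed.

Lemma graph_starHom : exists f : starHom A B, forall a b, G a b -> f a = b.
Proof.
have /choice [f Hf] := Gbar_ex.
have f_lin : linear f.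
  by move=> c x y; apply: (Gbar_fun (Hf _)); apply: Gbar_lin.
have f1 : f 1 = 1 by apply: (Gbar_fun (Hf _)); apply: G_Gbar.
have fM : {morph f : x y / x * y}.
  by move=> x y; apply: (Gbar_fun (Hf _)); apply: Gbar_mul.
have fS x : f (star x) = star (f x).
  by apply: (Gbar_fun (Hf _)); apply: Gbar_star.
exists (build_starHom f_lin f1 fM fS) => a b Gab.
by rewrite build_starHomE; apply: (Gbar_fun (Hf _)); apply: G_Gbar.
Qed.

End GraphExtension.

(** The inverse is the extension of the transposed graph of [f], so surjectivity
    is a consequence rather than something to check. *)
Lemma isometric_dense_iso (R : realType) (A B : cstarType R) (f : starHom A B) :
  (forall x, cnorm (f x) = cnorm x) ->
  (forall (b : B) (e : R), 0 < e -> exists a, cnorm (b - f a) < e) ->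
  exists v : starIso B A, forall a, star_isoV v a = f a.
Proof.
move=> fI fd; pose G (b : B) (a : A) := b = f a.
have [|||||b e e0|g gG] := @graph_starHom R B A G.
- by move=> c a b a' b' -> ->; rewrite /G linearP.
- by move=> a b a' b' -> ->; rewrite /G rmorphM.
- by move=> a b ->; rewrite /G star_homS.
- by rewrite /G rmorph1.
- by move=> a b ->; rewrite fI.
- by have [a Ha] := fd b e e0; exists (f a, a).
have fK : cancel f g by move=> a; apply: gG.
have gK : cancel g f.
  apply: (@starHom_eq_dense _ _ _ (@star_comp R _ _ _ f g) (id_starHom B)
    (fun b => exists a, b = f a)) => [b e e0|b [a ->]].
    by have [a Ha] := fd b e e0; exists (f a) => //; exists a.
  by rewrite /= fK.
by exists (StarIso gK fK).
Qed.

(** * Elementary tensors *)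

Section TensorSlots.
Variables (R : realType) (T : cstarTensor R) (J : finType) (A : J -> cstarType R).

Let one : forall j, A j := fun=> 1.

Definition slot_fun (j : J) (a : A j) : tobj T A :=
  tens T (eqtype.dfwith (T := fun j => A j) one a).

Lemma dfwith_one_ind (j : J) (a : A j) (P : forall i, A i -> Prop) :
  P j a -> (forall i, P i 1) ->
  forall i, P i (eqtype.dfwith (T := fun j => A j) one a i).
Proof.
move=> Pj P1 i; case: (eqVneq j i) => [ji|ji]; last by rewrite dfwith_out.
by case: i / ji; rewrite dfwith_in.
Qed.

Let slot_lin j : linear (@slot_fun j).
Proof. by move=> c x y; rewrite /slot_fun tens_multilinear. Qed.

Let slot_one j : @slot_fun j 1 = 1.
Proof.
rewrite -(tens1 T A) /slot_fun; congr (tens T); apply: functional_extensionality_dep.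
exact: (@dfwith_one_ind j 1 (fun i x => x = 1)).
Qed.

Let slotM j : {morph @slot_fun j : x y / x * y}.
Proof.
move=> x y; rewrite /slot_fun -tensM; congr (tens T).
apply: functional_extensionality_dep => i; case: (eqVneq j i) => [ji|ji].
  by case: i / ji; rewrite !dfwith_in.
by rewrite !dfwith_out // mulr1.
Qed.

Let slotS j (x : A j) : slot_fun (star x) = star (slot_fun x).
Proof.
rewrite /slot_fun -tens_star; congr (tens T).
apply: functional_extensionality_dep => i; case: (eqVneq j i) => [ji|ji].
  by case: i / ji; rewrite !dfwith_in.
by rewrite !dfwith_out // star1.
Qed.

Definition slot (j : J) : starHom (A j) (tobj T A) :=
  build_starHom (@slot_lin j) (slot_one j) (@slotM j) (@slotS j).

Lemma slotE j (a : A j) :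
  slot j a = tens T (eqtype.dfwith (T := fun j => A j) one a).
Proof. by []. Qed.

(** Elementary tensors factor into images of the homomorphisms [slot j].  Hence a
    homomorphism on a tensor product is determined by its values on the factors,
    and elementary tensors are limits of products of such values. *)
Lemma tens_slots (a : forall j, A j) :
  tens T a = \prod_(j <- enum J) slot j (a j).
Proof.
have H (s : seq J) : uniq s -> \prod_(j <- s) slot j (a j) =
    tens T (fun j => if j \in s then a j else 1 : A j).
  elim: s => [_|i s IH /= /andP[ni us]]; first by rewrite big_nil tens1.
  rewrite big_cons IH // -tensM; congr (tens T).
  apply: functional_extensionality_dep => j; rewrite inE eq_sym.
  case: (eqVneq i j) => [ij|ij]; last by rewrite dfwith_out // mul1r.
  by case: j / ij; rewrite dfwith_in (negPf ni) mulr1.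
rewrite H ?enum_uniq //; congr (tens T); apply: functional_extensionality_dep => j.
by rewrite mem_enum.
Qed.

Lemma tobj_hom_eq (B : cstarType R) (f g : starHom (tobj T A) B) :
  (forall a, f (tens T a) = g (tens T a)) -> forall t, f t = g t.
Proof.
move=> fg; pose S (t : tobj T A) := exists x : seq (R[i] * (forall j, A j)),
  t = \sum_(p <- x) p.1 *: tens T p.2.
apply: (@starHom_eq_dense _ _ _ f g S) => [t e e0|t [x ->]].
  by have [x Hx] := tens_dense t e0; exists (\sum_(p <- x) p.1 *: tens T p.2) => //; exists x.
by rewrite !linear_sum; apply: eq_bigr => p _; rewrite !linearZ /= fg.
Qed.

End TensorSlots.

Lemma groupCstar_hom_eq (R : realType) (G : groupType) (C : groupCstar R G)
    (B : cstarType R) (f g : starHom C B) :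
  (forall x, f (gW C x) = g (gW C x)) -> forall t, f t = g t.
Proof.
move=> fg; pose S (t : C) := exists x : seq (R[i] * G),
  t = \sum_(p <- x) p.1 *: gW C p.2.
apply: (@starHom_eq_dense _ _ _ f g S) => [t e e0|t [x ->]].
  by have [x Hx] := gW_dense t e0; exists (\sum_(p <- x) p.1 *: gW C p.2) => //; exists x.
by rewrite !linear_sum; apply: eq_bigr => p _; rewrite !linearZ /= fg.
Qed.

(** Functoriality of the tensor product makes split embeddings stay split; this
    is what replaces injectivity of the tensor norm. *)
Section ThomFunctor.
Variables (R : realType) (T : cstarTensor R) (J : finType).

Lemma thom_cancel (A B : J -> cstarType R) (f : forall j, starHom (A j) (B j))
    (g : forall j, starHom (B j) (A j)) :
  (forall j, cancel (f j) (g j)) -> cancel (thom T f) (thom T g).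
Proof.
move=> fK t; have := @tobj_hom_eq _ _ _ _ _ (star_comp (thom T g) (thom T f))
  (id_starHom _).
apply => a; rewrite /= !thomE; congr (tens T).
by apply: functional_extensionality_dep => j; rewrite fK.
Qed.

End ThomFunctor.

(** * Pulling back along maps of index sets *)

Section DiagonalFunctor.
Variables (R : realType) (n : nat) (T : cstarTensor R) (D : heisData n T).
Local Notation coords := (R * {poly_n.+1 R})%type.

Definition group_tensor (J : finType) (I : J -> borelQ R) : cstarType R :=
  tobj T (fun j => gcs (W0I D (I j))).

Definition gen (J : finType) (I : J -> borelQ R) (x : J -> coords) :
    group_tensor I :=
  tens T (fun j => gW (W0I D (I j)) (explI (I j) (x j).1 (x j).2)).

(** Tensor products of group algebras are generated by the images of the groups,
    factor by factor. *)
Lemma group_tensor_hom_eq (J : finType) (I : J -> borelQ R) (B : cstarType R)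
    (f g : starHom (group_tensor I) B) :
  (forall x, f (gen I x) = g (gen I x)) -> forall t, f t = g t.
Proof.
move=> fg; apply: tobj_hom_eq => a; rewrite tens_slots !rmorph_prod.
apply: eq_bigr => j _.
have := @groupCstar_hom_eq _ _ _ _ (star_comp f (slot T _ j)) (star_comp g (slot T _ j)).
apply=> x /=; rewrite /slot_fun.
(* The unit of each factor is the generator of the neutral element, so the
   image of [x] in slot [j] is again a tensor product of generators. *)
pose y : J -> coords := eqtype.dfwith (T := fun=> coords)
  (fun i => khatV (I i) 1%g) (i := j) x.
have -> : eqtype.dfwith (T := fun j => gcs (W0I D (I j))) (fun=> 1) (gW (W0I D (I j)) x) =
    fun i => gW (W0I D (I i)) (explI (I i) (y i).1 (y i).2).
  apply: functional_extensionality_dep => i; rewrite /y.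
  case: (eqVneq j i) => [ji|ji].
    by case: i / ji; rewrite !dfwith_in /explI; case: (x).
  by rewrite !dfwith_out // -(gW1 (W0I D (I i))).
exact: fg.
Qed.

End DiagonalFunctor.

(** For [f = parent] this is the connecting map of the inductive system, but [f]
    need not be surjective: over an empty fibre of [f] the diagonal homomorphism
    is the trivial representation.  The definition is locked since otherwise
    unification sees through it to the composite. *)
HB.lock Definition pullback (R : realType) (n : nat) (T : cstarTensor R)
    (D : heisData n T) (J K : finType) (I : J -> borelQ R) (I' : K -> borelQ R)
    (f : K -> J) : starHom (group_tensor D I) (group_tensor D I') :=
  star_comp (tassoc T f (fun k => gcs (W0I D (I' k))))
    (thom T (fun j => star_comp
       (hdiag D (fun k : {k : K | f k == j} => I' (val k))) (hs D (I j)))).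

Section PullbackFunctor.
Variables (R : realType) (n : nat) (T : cstarTensor R) (D : heisData n T).
Local Notation coords := (R * {poly_n.+1 R})%type.

Lemma pullbackE (J K : finType) (I : J -> borelQ R) (I' : K -> borelQ R)
    (f : K -> J) (x : J -> coords) :
  pullback D I I' f (gen D I x) = gen D I' (x \o f).
Proof.
pose b k := gW (W0I D (I' k)) (explI (I' k) (x (f k)).1 (x (f k)).2).
rewrite pullback.unlock /gen /= thomE -[RHS](tassocE T f b).
congr (tassoc T f _ _); congr (tens T).
apply: functional_extensionality_dep => j /=; rewrite hsE hdiagE; congr (tens T).
apply: functional_extensionality_dep => -[k fk] /=.
rewrite /b /= (eqP fk); apply: (can_inj (star_isoK (hs D (I' k)))).
rewrite star_isoVK hsE //.
Qed.

Lemma zmapE (I : borelQ R) (p q : borelPartition I) (pq : refines p q) :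
  zmap D pq = pullback D (fun j : p => val j) (fun k : q => val k) (parent pq).
Proof. by rewrite pullback.unlock. Qed.

Lemma pullback_comp (J K L : finType) (I : J -> borelQ R) (I' : K -> borelQ R)
    (I'' : L -> borelQ R) (f : K -> J) (g : L -> K) (h : L -> J) :
  f \o g =1 h ->
  forall t, pullback D I' I'' g (pullback D I I' f t) = pullback D I I'' h t.
Proof.
move=> fg t; have := @group_tensor_hom_eq _ _ _ D _ _ _
  (star_comp (pullback D I' I'' g) (pullback D I I' f)) (pullback D I I'' h).
apply=> x; rewrite !star_compE !pullbackE; congr (gen _ _ _).
by apply: functional_extensionality_dep => l /=; rewrite -fg.
Qed.

Lemma pullback_id (J : finType) (I : J -> borelQ R) (f : J -> J) :
  f =1 id -> forall t, pullback D I I f t = t.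
Proof.
move=> f1 t; have := @group_tensor_hom_eq _ _ _ D _ _ _ (pullback D I I f) (id_starHom _).
apply=> x; rewrite pullbackE; congr (gen _ _ _).
by apply: functional_extensionality_dep => l /=; rewrite f1.
Qed.

End PullbackFunctor.

(** * Partitions up to null sets *)

Section NullSets.
Variable R : realType.
Local Open Scope classical_set_scope.
Local Notation null := (@lebesgue_measure R).-negligible.
Local Notation bs J := (bset J : set R).
Implicit Types (I J K : borelQ R) (A B C : set R).

Let mbs J : measurable (bs J). Proof. exact: borel_measurable. Qed.

Let nullE A : measurable A -> null A <-> lebesgue_measure A = 0%E.
Proof. by move=> mA; exact: negligibleP. Qed.

Lemma ae_subP (A B : borelSet R) : ae_sub A B <-> null ((A : set R) `\` B).
Proof.
have m : measurable ((A : set R) `\` B) by apply: measurableD; exact: borel_measurable.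
by rewrite /ae_sub; split => [e|/nullE ->//]; apply/nullE.
Qed.

Lemma bset_not_null J : ~ null (bs J).
Proof.
move=> /nullE => /(_ (mbs J)) e.
by have := borel_gt0 (bset J); rewrite e ltxx.
Qed.

Lemma null_bigcup (T : choiceType) (D : {fset T}) (F : T -> set R) :
  (forall i, i \in D -> null (F i)) -> null (\bigcup_(i in [set` D]) F i).
Proof.
move=> h; rewrite bigcup_fset big_seq.
by apply: big_ind => [|A B|i]; [exact: negligible_set0|exact: negligibleU|exact: h].
Qed.

Lemma null_trans A B C : null (A `\` B) -> null (B `\` C) -> null (A `\` C).
Proof.
move=> AB BC; apply: negligibleS (negligibleU AB BC) => x [Ax nCx].
by have [Bx|nBx] := pselect (B x); [right|left].
Qed.

Lemma null_cap_sub A B C : null (A `\` B) -> null (B `&` C) -> null (A `&` C).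
Proof.
move=> AB BC; apply: negligibleS (negligibleU AB BC) => x [Ax Cx].
by have [Bx|nBx] := pselect (B x); [right|left].
Qed.

Lemma not_null_split A B : null (A `\` B) -> null (A `&` B) -> null A.
Proof.
move=> AB AB'; apply: negligibleS (negligibleU AB AB') => x Ax.
by have [Bx|nBx] := pselect (B x); [right|left].
Qed.

Section Cells.
Variables (I : borelQ R) (p : borelPartition I).

Lemma cell_sub J : J \in cells p -> null (bs J `\` bs I).
Proof.
move=> Jp; have [c _] := cells_cover p.
have mU : measurable ((\bigcup_(K in [set` cells p]) bs K) `\` bs I).
  by apply: measurableD => //; rewrite bigcup_fset; apply: bigsetU_measurable.
move/nullE: c => /(_ mU); apply: negligibleS => x [Jx nIx].
by split => //; exists J.
Qed.

Lemma cells_cover_null : null (bs I `\` \bigcup_(J in [set` cells p]) bs J).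
Proof.
have [_ c] := cells_cover p.
have mU : measurable (bs I `\` \bigcup_(K in [set` cells p]) bs K).
  by apply: measurableD => //; rewrite bigcup_fset; apply: bigsetU_measurable.
by move/nullE: c => /(_ mU).
Qed.

Lemma cells_null J K : J \in cells p -> K \in cells p -> J != K ->
  null (bs J `&` bs K).
Proof.
move=> Jp Kp JK; apply/(nullE (measurableI _ _ (mbs J) (mbs K))).
exact: (cells_disjoint Jp Kp).
Qed.

(** This is where positivity of the measure of all sets enters: two cells cannot
    share a non-null set. *)
Lemma cell_unique X J K : J \in cells p -> K \in cells p ->
  null (bs X `\` bs J) -> null (bs X `\` bs K) -> J = K.
Proof.
move=> Jp Kp XJ XK; apply/eqP/negPn/negP => JK; apply: (@bset_not_null X).
by apply: not_null_split XK _; apply: null_cap_sub XJ _; apply: cells_null.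
Qed.

End Cells.

Lemma build_partition I (D : {fset borelQ R}) :
  (forall J K, J \in D -> K \in D -> J != K -> null (bs J `&` bs K)) ->
  (forall J, J \in D -> null (bs J `\` bs I)) ->
  null (bs I `\` \bigcup_(J in [set` D]) bs J) ->
  exists p : borelPartition I, cells p = D.
Proof.
move=> disj sub cov.
have mU : measurable (\bigcup_(J in [set` D]) bs J).
  by rewrite bigcup_fset; apply: bigsetU_measurable.
have d J K : J \in D -> K \in D -> J != K -> lebesgue_measure (bs J `&` bs K) = 0%E.
  by move=> JD KD JK; apply/(nullE (measurableI _ _ (mbs J) (mbs K))); exact: disj.
have c : ae_eq_set (\bigcup_(J in [set` D]) bs J) (bs I).
  split.
    apply/(nullE (measurableD mU (mbs I))).
    by rewrite setD_bigcupl; exact: null_bigcup.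
  exact/(nullE (measurableD (mbs I) mU)).
by exists (BorelPartition d c).
Qed.

Lemma refinesP I (p q : borelPartition I) :
  (forall K, K \in cells q -> exists2 J, J \in cells p & null (bs K `\` bs J)) ->
  refines p q.
Proof.
move=> h k; have [J Jp KJ] := h _ (valP k).
by exists [` Jp]%fset; apply/ae_subP.
Qed.

Lemma refines_cell I (p q : borelPartition I) K : refines p q -> K \in cells q ->
  exists2 J, J \in cells p & null (bs K `\` bs J).
Proof.
move=> pq Kq; have [j /ae_subP] := pq [` Kq]%fset.
by exists (val j) => //; exact: valP.
Qed.

Lemma refines_refl I (p : borelPartition I) : refines p p.
Proof. by move=> k; exists k; exact: ae_sub_refl. Qed.

Lemma refines_trans I (p q r : borelPartition I) :
  refines p q -> refines q r -> refines p r.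
Proof.
move=> pq qr k; have [j kj] := qr k; have [i ji] := pq j.
by exists i; exact: ae_sub_trans kj ji.
Qed.

Lemma refines_trivial I (p : borelPartition I) : refines (trivial_partition I) p.
Proof.
by apply: refinesP => K Kp; exists I; [exact/fset1P|exact: cell_sub Kp].
Qed.

Lemma parentP I (p q : borelPartition I) (pq : refines p q) (k : q) :
  null (bs (val k) `\` bs (val (parent pq k))).
Proof. by apply/ae_subP; rewrite /parent; case: (cid _). Qed.

Lemma parentE I (p q : borelPartition I) (pq : refines p q) (k : q) (j : p) :
  null (bs (val k) `\` bs (val j)) -> parent pq k = j.
Proof.
move=> kj; apply: val_inj; apply: (cell_unique (valP _) (valP _) _ kj).
exact: parentP.
Qed.

(** The intersection as an element of [borelQ R]; its chosen representative
    agrees with it only up to null sets. *)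
Lemma borel_inter J K : ~ null (bs J `&` bs K) ->
  exists L, null (bs L `\` (bs J `&` bs K)) /\ null ((bs J `&` bs K) `\` bs L).
Proof.
move=> JK.
have b : bounded_set (bs J `&` bs K).
  have := borel_bounded (bset J); rewrite /bounded_set => h.
  near=> M; move=> x [Jx _]; move: x Jx.
  by near: M.
have m : measurable (bs J `&` bs K) by exact: measurableI.
have g : (0 < lebesgue_measure (bs J `&` bs K))%E.
  rewrite lt0e measure_ge0 andbT; apply/eqP => e.
  by apply: JK; apply/(nullE m).
pose L := BorelSet b m g.
exists (\pi_(borelQ R)%qT L).
have : borel_eq (bset (\pi_(borelQ R)%qT L)) L.
  by apply/eqmodP; rewrite /bset reprK.
by move=> /asboolP[/ae_subP LA /ae_subP AL].
Unshelve. all: by end_near.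
Qed.

(** The cells are the non-null intersections of a cell of [p] and a cell of
    [q]. *)
Lemma common_refinement I (p q : borelPartition I) :
  exists r : borelPartition I, refines p r /\ refines q r.
Proof.
have /choice [m mP] : forall x : borelQ R * borelQ R, exists L,
    ~ null (bs x.1 `&` bs x.2) ->
    null (bs L `\` (bs x.1 `&` bs x.2)) /\ null ((bs x.1 `&` bs x.2) `\` bs L).
  move=> x; have [n0|n0] := pselect (null (bs x.1 `&` bs x.2)); first by exists x.1.
  by have [L HL] := borel_inter n0; exists L.
pose E := [fset x in (cells p `*` cells q)%fset | `[< ~ null (bs x.1 `&` bs x.2) >]]%fset.
pose D := [fset m x | x in E]%fset.
have DP L : L \in D -> exists J K, [/\ J \in cells p, K \in cells q,
    L = m (J, K), null (bs L `\` bs J) & null (bs L `\` bs K)].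
  move=> /imfsetP[[J K] /=]; rewrite !inE /= => /andP[/andP[Jp Kq] /asboolP n0] ->.
  have [h _] := mP (J, K) n0.
  by exists J, K; split=> //; apply: negligibleS h => x [Lx n]; split=> // -[].
have [||| r rE] := @build_partition I D.
- move=> L L' /DP[J [K [Jp Kq -> LJ LK]]] /DP[J' [K' [Jp' Kq' -> LJ' LK']]] ne.
  have [eJ|nJ] := eqVneq J J'.
    have nK : K != K' by apply: contraNneq ne => eK; rewrite eJ eK.
    apply: null_cap_sub LK _; rewrite setIC; apply: null_cap_sub LK' _.
    by rewrite setIC; apply: (cells_null Kq Kq' nK).
  apply: null_cap_sub LJ _; rewrite setIC; apply: null_cap_sub LJ' _.
  by rewrite setIC; apply: (cells_null Jp Jp' nJ).
- move=> L /DP[J [K [Jp _ _ LJ _]]].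
  exact: null_trans LJ (cell_sub Jp).
- pose F (x : borelQ R * borelQ R) := (bs x.1 `&` bs x.2) `\` \bigcup_(L in [set` D]) bs L.
  have nF : null (\bigcup_(x in [set` (cells p `*` cells q)%fset]) F x).
    apply: null_bigcup => x; rewrite in_fsetM => xpq.
    have [n0|n0] := pselect (null (bs x.1 `&` bs x.2)).
      by apply: negligibleS n0 => y [].
    have [_ h] := mP _ n0; apply: negligibleS h => y [xy nD]; split => // Ly.
    apply: nD; exists (m x) => //=; apply/imfsetP; exists x => //=.
    by rewrite !inE xpq; apply/asboolP.
  apply: negligibleS (negligibleU (cells_cover_null p)
    (negligibleU (cells_cover_null q) nF)) => x [Ix nD].
  have [[J Jp Jx]|n0] := pselect ((\bigcup_(J in [set` cells p]) bs J) x); last by left.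
  have [[K Kq Kx]|n0] := pselect ((\bigcup_(J in [set` cells q]) bs J) x); last by right; left.
  by right; right; exists (J, K) => //=; rewrite in_fsetM /= Jp.
exists r; split; apply: refinesP => L; rewrite rE => /DP[J [K [Jp Kq _ LJ LK]]].
  by exists J.
by exists K.
Qed.

Section Restriction.
Variables (I : borelQ R) (p q : borelPartition I).

Lemma subpartition_ex (pq : refines p q) (j : p) : exists r : borelPartition (val j),
  cells r = [fset k in cells q | `[< null (bs k `\` bs (val j)) >]]%fset.
Proof.
set D := [fset k in _ | _]%fset.
have DP k : k \in D -> k \in cells q /\ null (bs k `\` bs (val j)).
  by rewrite !inE /= => /andP[-> /asboolP].
apply: build_partition => [J K /DP[Jq _] /DP[Kq _] JK|J /DP[]//|].
  exact: (cells_null Jq Kq JK).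
pose F k := if k \in D then set0 else bs k `&` bs (val j).
have nF : null (\bigcup_(k in [set` cells q]) F k).
  apply: null_bigcup => k kq; rewrite /F; case: ifPn => kD; first exact: negligible_set0.
  have [i ip ki] := refines_cell pq kq.
  apply: (null_cap_sub ki); apply: (cells_null ip (valP j)).
  apply: contraNneq kD => ij; rewrite !inE /= kq; apply/asboolP.
  by rewrite -ij.
apply: negligibleS (negligibleU (cell_sub (valP j))
  (negligibleU (cells_cover_null q) nF)) => x [jx nD].
have [Ix|n0] := pselect (bs I x); last by left.
have [[K Kq Kx]|n0] := pselect ((\bigcup_(J in [set` cells q]) bs J) x); last by right; left.
right; right; exists K => //; rewrite /F; case: ifPn => // KD.
by exfalso; apply: nD; exists K.
Qed.

Definition subpartition (pq : refines p q) (j : p) : borelPartition (val j) :=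
  projT1 (cid (subpartition_ex pq j)).

Lemma in_subpartition (pq : refines p q) (j : p) K :
  K \in cells (subpartition pq j) <-> K \in cells q /\ null (bs K `\` bs (val j)).
Proof.
rewrite /subpartition; case: (cid _) => r /= ->; rewrite !inE /=.
by split=> [/andP[-> /asboolP]|[-> h]] //; apply/asboolP.
Qed.

End Restriction.

Lemma refines_subpartition I (p q q' : borelPartition I) (pq : refines p q)
    (pq' : refines p q') (qq' : refines q q') (j : p) :
  refines (subpartition pq j) (subpartition pq' j).
Proof.
apply: refinesP => K /in_subpartition[Kq' Kj].
have [J Jq KJ] := refines_cell qq' Kq'; exists J => //.
apply/in_subpartition; split => //.
have [i ip Ji] := refines_cell pq Jq.
by rewrite -(cell_unique ip (valP j) (null_trans KJ Ji) Kj).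
Qed.

(** The cell [j] of [p] is replaced by the cells of [r].  Hence every partition of
    a cell is coarser than the trace of a partition of the whole set. *)
Lemma insert_partition I (p : borelPartition I) (j : p)
    (r : borelPartition (val j)) :
  exists (q : borelPartition I) (pq : refines p q), refines r (subpartition pq j).
Proof.
pose J := val j; have Jp : J \in cells p := valP j.
have [||| q qE] := @build_partition I ((cells p `\ J) `|` cells r)%fset.
- have H K L : K \in (cells p `\ J)%fset -> L \in cells r -> null (bs L `&` bs K).
    rewrite !inE => /andP[KJ Kp] Lr; apply: null_cap_sub (cell_sub Lr) _.
    by rewrite setIC; apply: (cells_null Kp).
  move=> K L; rewrite in_fsetU => /orP[Kp|Kr]; rewrite in_fsetU => /orP[Lp|Lr] KL.
  + by move: Kp Lp; rewrite !inE => /andP[_ Kp] /andP[_ Lp]; exact: (cells_null Kp).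
  + by rewrite setIC; exact: H.
  + exact: H.
  + exact: (cells_null Kr).
- move=> K; rewrite in_fsetU => /orP[|Kr]; first by rewrite !inE => /andP[_ /cell_sub].
  exact: null_trans (cell_sub Kr) (cell_sub Jp).
- apply: negligibleS (negligibleU (cells_cover_null p) (cells_cover_null r)) => x [Ix nq].
  have [[K Kp Kx]|n0] := pselect ((\bigcup_(J in [set` cells p]) bs J) x); last by left.
  have [KJ|KJ] := eqVneq K J; last first.
    by exfalso; apply: nq; exists K => //=; rewrite !inE KJ Kp.
  right; split; first by rewrite -/J -KJ.
  by move=> [L Lr Lx]; apply: nq; exists L => //=; rewrite in_fsetU Lr orbT.
have pq : refines p q.
  apply: refinesP => K; rewrite qE in_fsetU => /orP[|Kr].
    by rewrite !inE => /andP[_ Kp]; exists K => //; rewrite setDv; exact: negligible_set0.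
  by exists J => //; exact: cell_sub Kr.
exists q, pq; apply: refinesP => K /in_subpartition[]; rewrite qE in_fsetU => /orP[|Kr _].
  rewrite !inE => /andP[KJ Kp] KJ'; exfalso.
  apply: (@bset_not_null K); apply: not_null_split KJ' _; exact: (cells_null Kp Jp KJ).
by exists K => //; rewrite setDv; exact: negligible_set0.
Qed.

(** * Ultrafilters selecting cells *)

(** The sets that are conull in [J] form a proper filter because [J] has positive
    measure. *)
Lemma conull_ultra J : exists U : set_system R,
  UltraFilter U /\ forall S, null (bs J `\` S) -> U S.
Proof.
pose F : set_system R := [set S | null (bs J `\` S)].
have FF : ProperFilter F.
  apply: Build_ProperFilter.
    by rewrite /F /= setD0; exact: bset_not_null.
  split; rewrite /F /=.
  - by rewrite setDT; exact: negligible_set0.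
  - move=> A B /= FA FB; apply: negligibleS (negligibleU FA FB) => x [Jx nAB].
    have [Ax|nA] := pselect (A x); last by left.
    by right; split => // Bx; apply: nAB.
  - by move=> A B AB FA; apply: negligibleS FA => x [Jx nB]; split => // /AB.
by have [U [UU FU]] := ultraFilterLemma FF; exists U; split.
Qed.

Definition ultra J : set_system R := projT1 (cid (conull_ultra J)).

Lemma ultra_ultra J : UltraFilter (ultra J).
Proof. by have [] := projT2 (cid (conull_ultra J)). Qed.

Lemma ultra_conull J S : null (bs J `\` S) -> ultra J S.
Proof. by have [_] := projT2 (cid (conull_ultra J)); exact. Qed.

Lemma ultra_ae_sub J A B : null (A `\` B) -> ultra J A -> ultra J B.
Proof.
move=> AB UA; have UU := ultra_ultra J.
have UN : ultra J (~` (A `\` B)).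
  by apply: ultra_conull; apply: negligibleS AB => x [_ /contrapT].
apply: filterS (filterI UA UN) => x [Ax n].
by apply: contrapT => nB; apply: n.
Qed.

Lemma ultra_not_null J A : null A -> ~ ultra J A.
Proof.
move=> A0 UA; have UU := ultra_ultra J.
have : ultra J set0 by apply: ultra_ae_sub UA; rewrite setD0.
exact: filter_not_empty.
Qed.

Lemma ultra_cell I (p : borelPartition I) J : null (bs J `\` bs I) ->
  exists k : p, ultra J (bs (val k)).
Proof.
move=> JI; have UU := ultra_ultra J; apply: contrapT => n.
have U1 : ultra J (\bigcap_(k in [set` cells p]) ~` bs k).
  apply: filter_bigI => k kp; have [Uk|//] := in_ultra_setVsetC (bs k) UU.
  by exfalso; apply: n; exists [` kp]%fset.
have U2 : ultra J (\bigcup_(k in [set` cells p]) bs k).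
  by apply: ultra_conull; apply: null_trans JI (cells_cover_null p).
apply: (ultra_not_null _ (filterI U1 U2)).
rewrite (_ : _ `&` _ = set0) ?set0I; first exact: negligible_set0.
by apply/seteqP; split => // x [h [K Kp Kx]]; exact: (h K Kp).
Qed.

Lemma ultra_cell_unique I (p : borelPartition I) J (k k' : p) :
  ultra J (bs (val k)) -> ultra J (bs (val k')) -> k = k'.
Proof.
move=> Uk Uk'; apply/eqP/negPn/negP => kk'; have UU := ultra_ultra J.
apply: (ultra_not_null _ (filterI Uk Uk')).
exact: (cells_null (valP k) (valP k')).
Qed.

Section Select.
Variables (I : borelQ R) (p : borelPartition I).

(** An ultrafilter contains exactly one cell of each partition.  The one attached
    to a cell [k] plays the role of a point of [k] in general position, and
    [select q k] is the cell of [q] around that point. *)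
Definition select (q : borelPartition I) (k : p) : q :=
  projT1 (cid (ultra_cell q (cell_sub (valP k)))).

Lemma selectP (q : borelPartition I) (k : p) : ultra (val k) (bs (val (select q k))).
Proof. by rewrite /select; case: (cid _). Qed.

Lemma selectE (q : borelPartition I) (k : p) (l : q) :
  ultra (val k) (bs (val l)) -> select q k = l.
Proof. by move=> Ul; apply: (ultra_cell_unique _ Ul); exact: selectP. Qed.

Lemma select_id : select p =1 id.
Proof.
by move=> k; apply/selectE/ultra_conull; rewrite setDv; exact: negligible_set0.
Qed.

(** The selected cells form a thread through all partitions: the coarse cell
    around a selected fine cell is again selected. *)
Lemma select_parent (q q' : borelPartition I) (qq' : refines q q') :
  parent qq' \o select q' =1 select q.
Proof.
move=> k; apply/esym/selectE; apply: ultra_ae_sub (selectP q' k).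
exact: parentP.
Qed.

End Select.

End NullSets.

(** * Homomorphisms out of the inductive limit *)

Section LimitMaps.
Variables (R : realType) (n : nat) (T : cstarTensor R) (D : heisData n T).
Variables (I : borelQ R) (L : heisLimit D I).

(** The universal property of the limit.  Prescribing the homomorphism on the
    partitions finer than [p] is enough since these are cofinal, and contractivity
    lets it extend to the completion. *)
Lemma limit_hom (B : cstarType R) (p : borelPartition I)
    (h : forall q, refines p q -> starHom (Wpart D q) B) :
  (forall q q' (pq : refines p q) (pq' : refines p q') (qq' : refines q q') x,
     h q' pq' (zmap D qq' x) = h q pq x) ->
  exists f : starHom L B, forall q pq x, f (zlim L q x) = h q pq x.
Proof.
move=> hC; pose G (a : L) (b : B) := exists q (pq : refines p q) x,
  a = zlim L q x /\ b = h q pq x.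
have G2 a b a' b' : G a b -> G a' b' -> exists q (pq : refines p q) x x',
    [/\ a = zlim L q x, b = h q pq x, a' = zlim L q x' & b' = h q pq x'].
  move=> [q [pq [x [-> ->]]]] [q' [pq' [x' [-> ->]]]].
  have [r [qr qr']] := common_refinement q q'.
  exists r, (refines_trans pq qr), (zmap D qr x), (zmap D qr' x').
  by rewrite !zlim_compat !(hC _ _ _ (refines_trans pq qr)).
have [|||||a e e0|f fG] := @graph_starHom R L B G.
- move=> c a b a' b' /G2 h2 /h2 [q [pq [x [x' [-> -> -> ->]]]]].
  by exists q, pq, (c *: x + x'); rewrite !linearP.
- move=> a b a' b' /G2 h2 /h2 [q [pq [x [x' [-> -> -> ->]]]]].
  by exists q, pq, (x * x'); rewrite !rmorphM.
- by move=> a b [q [pq [x [-> ->]]]]; exists q, pq, (star x); rewrite !star_homS.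
- by exists p, (@refines_refl _ _ p), 1; rewrite !rmorph1.
- by move=> a b [q [pq [x [-> ->]]]]; rewrite zlim_norm starHom_contractive.
- have [q [x ax]] := zlim_dense a e0; have [r [pr qr]] := common_refinement p q.
  exists (zlim L q x, h r pr (zmap D qr x)) => //=.
  by exists r, pr, (zmap D qr x); rewrite zlim_compat.
by exists f => q pq x; apply: fG; exists q, pq, x.
Qed.

(** The pullbacks along [select q] are compatible in [q], and at [q = p] the map
    [select p] is the identity. *)
Lemma zlim_retraction_ex (p : borelPartition I) :
  exists g : starHom L (Wpart D p), cancel (zlim L p) g.
Proof.
pose h q (_ : refines p q) : starHom (Wpart D q) (Wpart D p) :=
  pullback D (fun k : q => val k) (fun k : p => val k) (select q).
have [q q' pq pq' qq' x|g gE] := @limit_hom _ p h.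
  by rewrite /h zmapE (pullback_comp _ _ (@select_parent _ _ p _ _ qq')).
exists g => x; rewrite (gE _ (@refines_refl _ _ p)) /h pullback_id //; exact: select_id.
Qed.

Definition zlim_retraction p : starHom L (Wpart D p) :=
  projT1 (cid (zlim_retraction_ex p)).

Lemma zlim_retractionK p : cancel (zlim L p) (zlim_retraction p).
Proof. exact: (projT2 (cid (zlim_retraction_ex p))). Qed.

End LimitMaps.

(** * Factorization *)

(** A cell of [q] inside the cell [j] of [p] appears in two guises: as a member of
    the partition of [j] traced by [q], and as a point of the fibre of [parent]
    over [j], which is how iterated tensor products index it. *)
Section Fibres.
Variables (R : realType) (I : borelQ R) (p q : borelPartition I).
Variables (pq : refines p q) (j : p).

Definition subpartition_incl (k : subpartition pq j) : q :=
  [` proj1 (proj1 (in_subpartition pq j (val k)) (valP k))]%fset.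

Lemma subpartition_incl_parent (k : subpartition pq j) :
  parent pq (subpartition_incl k) == j.
Proof.
apply/eqP/parentE; exact: (proj2 (proj1 (in_subpartition pq j (val k)) (valP k))).
Qed.

Definition to_fibre (k : subpartition pq j) : {k : q | parent pq k == j} :=
  exist _ (subpartition_incl k) (subpartition_incl_parent k).

Lemma of_fibre_subproof (k : {k : q | parent pq k == j}) :
  val (val k) \in cells (subpartition pq j).
Proof.
apply/in_subpartition; split; first exact: valP.
by have := parentP pq (val k); rewrite (eqP (valP k)).
Qed.

Definition of_fibre (k : {k : q | parent pq k == j}) : subpartition pq j :=
  [` of_fibre_subproof k]%fset.

Lemma to_fibreK : of_fibre \o to_fibre =1 id.
Proof. by move=> k; apply: val_inj. Qed.

Lemma of_fibreK : to_fibre \o of_fibre =1 id.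
Proof. by move=> k; apply: val_inj; apply: val_inj. Qed.

End Fibres.

Section Factorization.
Variables (R : realType) (n : nat) (T : cstarTensor R) (D : heisData n T).
Variable W : forall I : borelQ R, heisLimit D I.
Variables (I : borelQ R) (p : borelPartition I).
Local Notation coords := (R * {poly_n.+1 R})%type.
Local Notation W0 q := (fun k : q => gcs (W0I D (val k))).
Local Notation WT := (tobj T (fun j : p => Wlim (W (val j)))).

Section Split.
Variables (q : borelPartition I) (pq : refines p q).

Let fib (j : p) := fun k : {k : q | parent pq k == j} => val (val k).
Let res (j : p) := fun k : subpartition pq j => val k.

Definition split_cell (j : p) :
    starHom (group_tensor D (@fib j)) (Wlim (W (val j))) :=
  star_comp (zlim (W (val j)) (subpartition pq j))
    (pullback D (@fib j) (@res j) (@to_fibre _ _ _ _ pq j)).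

Definition split_hom : starHom (Wpart D q) WT :=
  star_comp (thom T split_cell) (star_isoV (tassoc T (parent pq) (W0 q))).

Let split_cellV (j : p) :
    starHom (Wlim (W (val j))) (group_tensor D (@fib j)) :=
  star_comp (pullback D (@res j) (@fib j) (@of_fibre _ _ _ _ pq j))
    (zlim_retraction (W (val j)) (subpartition pq j)).

Let split_cellK j : cancel (split_cell j) (split_cellV j).
Proof.
move=> x; rewrite /split_cell /split_cellV !star_compE zlim_retractionK.
by rewrite (pullback_comp _ _ (@of_fibreK _ _ _ _ pq j)) pullback_id.
Qed.

(** The left inverses [split_cellV] pass to the tensor product over [j]. *)
Lemma split_hom_norm x : cnorm (split_hom x) = cnorm x.
Proof.
apply: (@starHom_isometric _ _ _ split_hom
  (star_comp (tassoc T (parent pq) (W0 q)) (thom T split_cellV))) => y.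
rewrite /split_hom !star_compE thom_cancel; first by rewrite star_isoVK.
exact: split_cellK.
Qed.

Lemma split_hom_gen (x : q -> coords) :
  split_hom (gen D (fun k : q => val k) x) =
  tens T (fun j : p => zlim (W (val j)) (subpartition pq j)
    (gen D (@res j) (x \o @subpartition_incl _ _ _ _ pq j))).
Proof.
have -> : gen D (fun k : q => val k) x = tassoc T (parent pq) (W0 q)
    (tens T (fun j : p => gen D (@fib j) (x \o val))).
  by rewrite [RHS](tassocE T (parent pq)
    (fun k : q => gW (W0I D (val k)) (explI (val k) (x k).1 (x k).2))).
rewrite /split_hom star_compE star_isoK thomE; congr (tens T).
apply: functional_extensionality_dep => j; rewrite /split_cell star_compE.
by rewrite pullbackE.
Qed.

Lemma split_hom_onto (y : forall j : p, Wpart D (subpartition pq j)) :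
  exists x, split_hom x = tens T (fun j : p => zlim (W (val j)) (subpartition pq j) (y j)).
Proof.
exists (tassoc T (parent pq) (W0 q) (tens T (fun j : p =>
  pullback D (@res j) (@fib j) (@of_fibre _ _ _ _ pq j) (y j)))).
rewrite /split_hom star_compE star_isoK thomE; congr (tens T).
apply: functional_extensionality_dep => j; rewrite /split_cell star_compE.
congr (zlim _ _ _); by rewrite (pullback_comp _ _ (@to_fibreK _ _ _ _ pq j)) pullback_id.
Qed.

End Split.

(** Both sides need only be compared on tensor products of generators, where the
    connecting maps of [I] and those of the cells of [p] act by the same
    relabelling. *)
Lemma split_hom_compat (q q' : borelPartition I) (pq : refines p q)
    (pq' : refines p q') (qq' : refines q q') x :
  split_hom pq' (zmap D qq' x) = split_hom pq x.
Proof.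
apply: (@group_tensor_hom_eq _ _ _ D _ _ _
  (star_comp (split_hom pq') (zmap D qq')) (split_hom pq)) => {}x.
rewrite star_compE zmapE pullbackE !split_hom_gen; congr (tens T).
apply: functional_extensionality_dep => j.
have r : refines (subpartition pq j) (subpartition pq' j).
  exact: refines_subpartition.
rewrite -(zlim_compat (W (val j)) r) zmapE pullbackE; congr (zlim _ _ (gen _ _ _)).
apply: functional_extensionality_dep => k /=; congr (x _).
by apply: parentE; exact: parentP r k.
Qed.

(** The limit of the maps [split_hom] is isometric because each of them is.  The
    closure [S] of its range is a subalgebra, so it is everything as soon as it
    contains each factor [W_{I_j}]; and an element of [W_{I_j}] coming from a
    partition of [I_j] is reached through a partition of [I] that subdivides only
    the cell [I_j] accordingly. *)
Lemma factorization : exists u : starIso WT (Wlim (W I)),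
  forall q (pq : refines p q) x, star_isoV u (zlim (W I) q x) = split_hom pq x.
Proof.
have [f fE] := limit_hom (W I) split_hom_compat.
have fI x : cnorm (f x) = cnorm x.
  apply/eqP; rewrite eq_le starHom_contractive /=.
  apply/ler_addgt0Pr => e e0.
  have [|q [y xy]] := zlim_dense x (e := e / 2); first by rewrite divr_gt0.
  have [r [pr qr]] := common_refinement p q.
  rewrite -(zlim_compat (W I) qr) in xy; set z := zmap D qr y in xy.
  have H1 : cnorm (f (zlim (W I) r z)) = cnorm (zlim (W I) r z).
    by rewrite (fE _ pr) split_hom_norm zlim_norm.
  set s := zlim (W I) r z in xy H1.
  have H2 := starHom_contractive f (s - x); rewrite rmorphB cdistC in H2.
  have H3 := cnormD (x - s) s; rewrite subrK in H3.
  have H4 := cnormD (f s - f x) (f x); rewrite subrK in H4.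
  rewrite (cdistC s x) (cdistC (f x)) in H2; lra.
pose S b := forall e : R, 0 < e -> exists a, cnorm (b - f a) < e.
have S_lin c b b' : S b -> S b' -> S (c *: b + b').
  move=> Sb Sb' e e0; have [d d0 Hd] := lin_close c b b' e0.
  have [a ab] := Sb _ d0; have [a' ab'] := Sb' _ d0.
  by exists (c *: a + a'); rewrite linearP; apply: Hd.
have S_mul b b' : S b -> S b' -> S (b * b').
  move=> Sb Sb' e e0; have [d d0 Hd] := mul_close b b' e0.
  have [a ab] := Sb _ d0; have [a' ab'] := Sb' _ d0.
  by exists (a * a'); rewrite rmorphM; apply: Hd.
have Sf a : S (f a) by move=> e e0; exists a; rewrite subrr cnorm0.
have S_slot (j : p) (w : Wlim (W (val j))) : S (slot T (fun j : p => Wlim (W (val j))) j w).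
  move=> e e0; have [r [y wy]] := zlim_dense w e0.
  have [q [pq rq]] := insert_partition r.
  pose z := zmap D rq y.
  have [x fx] := @split_hom_onto q pq (eqtype.dfwith (T := fun j : p =>
    Wpart D (subpartition pq j)) (fun=> 1) z).
  have e1 : f (zlim (W I) q x) =
      slot T (fun j : p => Wlim (W (val j))) j (zlim (W (val j)) r y).
    rewrite (fE _ pq) fx slotE; congr (tens T).
    apply: functional_extensionality_dep => i; case: (eqVneq j i) => [ji|ji].
      by case: i / ji; rewrite !dfwith_in zlim_compat.
    by rewrite !dfwith_out // rmorph1.
  exists (zlim (W I) q x); rewrite e1 -rmorphB.
  exact: le_lt_trans (starHom_contractive _ _) wy.
have S_tens (w : forall j : p, Wlim (W (val j))) : S (tens T w).
  rewrite tens_slots; apply: big_ind => [|b b'|j _]; last exact: S_slot.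
    by rewrite -(rmorph1 f); exact: Sf.
  exact: S_mul.
have [b e e0|u uf] := isometric_dense_iso fI; last first.
  by exists u => q pq x; rewrite uf.
have [s bs] := tens_dense b e0.
have : S (\sum_(i <- s) i.1 *: tens T i.2).
  apply: big_ind => [|x y Sx Sy|i _].
  - by rewrite -(rmorph0 f); exact: Sf.
  - by rewrite -[x]scale1r; exact: S_lin.
  - by rewrite -[_ *: _]addr0; apply: S_lin => //; rewrite -(rmorph0 f); exact: Sf.
move=> /(_ (e - cnorm (b - \sum_(i <- s) i.1 *: tens T i.2))).
rewrite subr_gt0 => /(_ bs) [a Ha]; exists a.
apply: le_lt_trans (cdist_tri (\sum_(i <- s) i.1 *: tens T i.2) _ _) _; lra.
Qed.

End Factorization.

(** The operator [W_I(a, P)] is defined over the one-cell partition; the connecting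
    map moves it to [p], where it is the tensor product of the generators
    [W_{I_j}(a, P)]. *)
Theorem theorem1 (R : realType) (n : nat) (hn : (1 <= n)%N)
    (T : cstarTensor R) (D : heisData n T)
    (W : forall I : borelQ R, heisLimit D I) :
  exists u : forall (I : borelQ R) (p : borelPartition I),
      starIso (tobj T (fun j : p => Wlim (W (val j)))) (Wlim (W I)),
    forall (I : borelQ R) (a : R) (P : {poly_n.+1 R}) (p : borelPartition I),
      exists w : forall j : p, Wlim (W (val j)),
        star_isoV (u I p) (WI (W I) a P) = tens T w.
Proof.
exists (fun I p => projT1 (cid (factorization W p))) => I a P p.
case: (cid _) => u uE; rewrite [projT1 _]/=.
have tp : refines (trivial_partition I) p by exact: refines_trivial.
have WIE : WI (W I) a P = zlim (W I) p (gen D (fun k : p => val k) (fun=> (a, P))).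
  rewrite /WI -(zlim_compat (W I) tp) zmapE.
  exact: (congr1 (zlim (W I) p) (@pullbackE _ _ _ D _ _
    (fun j : trivial_partition I => val j) _ _ (fun=> (a, P)))).
rewrite WIE (uE _ (@refines_refl _ _ p)) split_hom_gen.
by eexists.
Qed.
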